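(* Assume (A1)--(A4) below. Let $(x^k,\mathbf y^k,\mathbf z^k)_{k\ge 0}$ be generated by Walkman, either in the proximal variant with $\beta>\max\{\gamma,2L+2\}$, or in the gradient variant with $\beta>\max\{\gamma,2L^2+L+2\}$. Then any limit point $(x^*,\mathbf y^*,\mathbf z^* )$ of the sequence $(x^k,\mathbf y^k,\mathbf z^k)$ satisfies, with probability $1$, $x^*=y_i^*$ for $i=1,\dots,n$, and $x^*$ is a stationary point of the problem $\min_{x\in\mathbb R^p} r(x)+\frac1n\sum_{i=1}^n f_i(x)$, that is, $$\Pr\Big(0\in\partial r(x^* )+\frac1n\sum_{i=1}^n\nabla f_i(x^* )\Big)=1.$$ If the objective $r+\frac1n\sum_{i=1}^n f_i$ is convex, then $x^*$ is a minimizer.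
   Context: Setting. $V=\{1,\dots,n\}$ is the set of agents; $f_i:\mathbb R^p\to\mathbb R$ ($i\in V$) and $r:\mathbb R^p\to\mathbb R\cup\{+\infty\}$ are possibly nonconvex; the problem is $\min_{x\in\mathbb R^p} r(x)+\frac1n\sum_{i=1}^n f_i(x)$. Norms are Euclidean; $\partial$ is the general (limiting) subdifferential in the sense of Rockafellar--Wets. $\mathbf y=\mathrm{col}\{y_1,\dots,y_n\}\in\mathbb R^{np}$ and $\mathbf z=\mathrm{col}\{z_1,\dots,z_n\}\in\mathbb R^{np}$. The proximal operator is $\mathbf{prox}_{\alpha f}(x)=\arg\min_y f(y)+\frac1{2\alpha}\|y-x\|^2$. Walkman. Let $\beta>0$ and let $(i_k)_{k\ge0}$, $i_k\in V$, be the random walk (sequence of activated agents). Initialize $y_i^0,z_i^0$ so that $\bar x^1=\frac1n\sum_{i=1}^n(y_i^0-z_i^0/\beta)=0$. For $k=0,1,2,\dots$: (a) $x^{k+1}=\mathbf{prox}_{\frac1\beta r}(\bar x^{k+1})$; (b) proximal variant: $y_{i_k}^{k+1}=\mathbf{prox}_{\frac1\beta f_{i_k}}\big(x^{k+1}+\frac{z_{i_k}^k}\beta\big)$; gradient variant: $y_{i_k}^{k+1}=x^{k+1}+\frac1\beta z_{i_k}^k-\frac1\beta\nabla f_{i_k}(y_{i_k}^k)$; in both variants $y_i^{k+1}=y_i^k$ for $i\ne i_k$; (c) $z_{i_k}^{k+1}=z_{i_k}^k+\beta(x^{k+1}-y_{i_k}^{k+1})$ and $z_i^{k+1}=z_i^k$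 for $i\neq i_k$; (d) $\bar x^{k+2}=\bar x^{k+1}+\frac1n\big(y_{i_k}^{k+1}-\frac{z_{i_k}^{k+1}}\beta\big)-\frac1n\big(y_{i_k}^{k}-\frac{z_{i_k}^{k}}\beta\big)$. Assumptions. (A1) $(i_k)_{k\ge0}$ is an irreducible and aperiodic (time-homogeneous) Markov chain on $V$ with transition matrix $\mathbf P$, $[\mathbf P]_{ij}=p(i_{k+1}=j\mid i_k=i)$, and stationary distribution $\pi$, $\pi^{\mathsf T}\mathbf P=\pi^{\mathsf T}$. (A2) The objective $r+\frac1n\sum_i f_i$ is bounded from below on $\mathbb R^p$ and coercive: it tends to $\infty$ along every sequence with $\|x^k\|\to\infty$. (A3) Each $f_i$ is $L$-Lipschitz differentiable: $\|\nabla f_i(u)-\nabla f_i(v)\|\le L\|u-v\|$ for all $u,v\in\mathbb R^p$. (A4) $r$ is lower semicontinuous and $\gamma$-semiconvex: $r+\frac\gamma2\|\cdot\|^2$ is convex, equivalently $r(y)+\frac\gamma2\|y-x\|^2\ge r(x)+\langle d,y-x\rangle$ for all $x,y$ and all $d\in\partial r(x)$. *)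

(* Defs.v *)
From HB Require Import structures.
From mathcomp Require Import all_boot all_order all_algebra.
From mathcomp Require Import all_classical all_reals all_analysis.

Set Implicit Arguments.
Unset Strict Implicit.
Unset Printing Implicit Defensive.

Import Order.TTheory GRing.Theory Num.Theory.
Import numFieldNormedType.Exports.

Local Open Scope classical_set_scope.
Local Open Scope ring_scope.

Section euclidean.
Context {R : realType} {p : nat}.
Implicit Types (u v x : 'rV[R]_p) (f : 'rV[R]_p -> R).

Definition dotp u v : R := \sum_(j < p) u 0 j * v 0 j.

(* The library norm on 'rV[R]_p is the sup norm (with the same topology). *)
Definition enorm u : R := Num.sqrt (dotp u u).

(* Meaningful only where f is differentiable. *)
Definition grad f x : 'rV[R]_p := \row_(j < p) 'D_(delta_mx 0 j) f x.

Definition lipschitz_differentiable (L : R) f : Prop :=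
  (forall x, differentiable f x) /\
  (forall u v, enorm (grad f u - grad f v) <= L * enorm (u - v)).

End euclidean.

(* Functions are [h : 'rV[R]_p -> \bar R] that never take the value -oo. *)
Section variational.
Context {R : realType} {p : nat}.
Implicit Types (h : 'rV[R]_p -> \bar R) (x y v d : 'rV[R]_p).

(* 0 * +oo = 0 in \bar R, so t = 0 and t = 1 impose nothing. *)
Definition convex_ext h : Prop :=
  forall x y (t : R), 0 <= t <= 1 ->
    (h (t *: x + (1 - t) *: y)%R <= t%:E * h x + (1 - t)%:E * h y)%E.

Definition semiconvex (gamma : R) h : Prop :=
  convex_ext (fun x => (h x + (gamma / 2 * enorm x ^+ 2)%:E)%E).

(* Following Rockafellar--Wets, argmin h is empty when h is identically +oo. *)
Definition argmin h : set 'rV[R]_p :=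
  [set x | (h x < +oo)%E /\ forall y, (h x <= h y)%E].

Definition prox (alpha : R) h x : set 'rV[R]_p :=
  argmin (fun y => (h y + ((2 * alpha)^-1 * enorm (y - x) ^+ 2)%:E)%E).

(* v such that h y >= h x + <v, y - x> + o(|y - x|) as y -> x *)
Definition regular_subdiff h x : set 'rV[R]_p :=
  [set v | h x \is a fin_num /\
    forall e : R, 0 < e -> \forall y \near x,
      (h x + (dotp v (y - x) - e * enorm (y - x))%:E <= h y)%E].

Definition limiting_subdiff h x : set 'rV[R]_p :=
  [set d | h x \is a fin_num /\
    exists (u v : nat -> 'rV[R]_p),
      [/\ u k @[k --> \oo] --> x,
          h (u k) @[k --> \oo] --> h x,
          forall k, regular_subdiff h (u k) (v k)
        & v k @[k --> \oo] --> d]].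

Definition bounded_below h : Prop := exists m : R, forall x, (m%:E <= h x)%E.

Definition coercive h : Prop :=
  forall u : nat -> 'rV[R]_p,
    enorm (u k) @[k --> \oo] --> +oo -> h (u k) @[k --> \oo] --> +oo%E.

End variational.

Section composite.
Context {R : realType} {n p : nat}.
Variables (r : 'rV[R]_p -> \bar R) (f : 'I_n -> 'rV[R]_p -> R).

Definition objective (x : 'rV[R]_p) : \bar R :=
  (r x + (n%:R^-1 * \sum_(i < n) f i x)%:E)%E.

Definition stationary (x : 'rV[R]_p) : Prop :=
  [set d + n%:R^-1 *: \sum_(i < n) grad (f i) x | d in limiting_subdiff r x] 0.

End composite.

Section markov_chain.
Context {R : realType} {n : nat}.
Implicit Types M : 'M[R]_n.

Definition stochastic M : Prop :=
  (forall i j, 0 <= M i j) /\ (forall i, \sum_(j < n) M i j = 1).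

Definition irreducible_chain M : Prop :=
  forall i j, exists m : nat, 0 < (M ^+ m) i j.

(* gcd {m >= 1 | (M ^+ m) i i > 0} = 1 for every i *)
Definition aperiodic_chain M : Prop :=
  forall (i : 'I_n) (g : nat),
    (forall m : nat, (0 < m)%N -> 0 < (M ^+ m) i i -> (g %| m)%N) -> g = 1%N.

Definition stationary_distribution M (q : 'rV[R]_n) : Prop :=
  [/\ forall i, 0 <= q 0 i, \sum_(i < n) q 0 i = 1 & q *m M = q].

Context {d : measure_display} {Omega : measurableType d}.

Definition cond_prob (Pr : probability Omega R) (A B : set Omega) : R :=
  fine (Pr (A `&` B)) / fine (Pr B).

(* The law of the initial state is arbitrary. *)
Definition markov_chain (Pr : probability Omega R) M
    (i_ : nat -> Omega -> 'I_n) : Prop :=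
  (forall k a, measurable (i_ k @^-1` [set a])) /\
  (forall (k : nat) (a : nat -> 'I_n) (j : 'I_n),
     let past := [set w | forall m, (m <= k)%N -> i_ m w = a m] in
     (0 < Pr past)%E ->
     cond_prob Pr (i_ k.+1 @^-1` [set j]) past = M (a k) j).

End markov_chain.

Section walkman.
Context {R : realType} {n p : nat}.
Variables (r : 'rV[R]_p -> \bar R) (f : 'I_n -> 'rV[R]_p -> R) (beta : R).

(* The stacked vectors y, z of R^(np) are n x p matrices, row i being the
   local variable of agent i. An update rule relates the active agent i, the new
   x, the current y_i and z_i, and the new y_i. *)
Definition update_rule : Type :=
  'I_n -> 'rV[R]_p -> 'rV[R]_p -> 'rV[R]_p -> 'rV[R]_p -> Prop.

Definition prox_update : update_rule := fun i x yi zi yi' =>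
  prox beta^-1 (fun u => (f i u)%:E) (x + beta^-1 *: zi) yi'.

Definition grad_update : update_rule := fun i x yi zi yi' =>
  yi' = x + beta^-1 *: zi - beta^-1 *: grad (f i) yi.

(* x 0 and xbar 0 are not produced by the algorithm and are left free. *)
Record walkman (upd : update_rule) (y0 z0 : 'M[R]_(n, p)) (i_ : nat -> 'I_n)
    (x xbar : nat -> 'rV[R]_p) (y z : nat -> 'M[R]_(n, p)) : Prop := Walkman {
  walkman_y0 : y 0%N = y0;
  walkman_z0 : z 0%N = z0;
  walkman_xbar1 :
    xbar 1%N = n%:R^-1 *: \sum_(i < n) (row i y0 - beta^-1 *: row i z0);
  walkman_x : forall k, prox beta^-1 r (xbar k.+1) (x k.+1);
  walkman_y : forall k,
    upd (i_ k) (x k.+1) (row (i_ k) (y k)) (row (i_ k) (z k))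
      (row (i_ k) (y k.+1));
  walkman_y_idle : forall k i, i != i_ k -> row i (y k.+1) = row i (y k);
  walkman_z : forall k,
    row (i_ k) (z k.+1) =
      row (i_ k) (z k) + beta *: (x k.+1 - row (i_ k) (y k.+1));
  walkman_z_idle : forall k i, i != i_ k -> row i (z k.+1) = row i (z k);
  walkman_xbar : forall k,
    xbar k.+2 = xbar k.+1
      + n%:R^-1 *: (row (i_ k) (y k.+1) - beta^-1 *: row (i_ k) (z k.+1))
      - n%:R^-1 *: (row (i_ k) (y k) - beta^-1 *: row (i_ k) (z k)) }.

End walkman.

(* Main.v *)
(**
The augmented Lagrangian, augmented by the terms (L^2/beta) |y_i - g_i|^2 where
g_i is the point at which agent i last evaluated its gradient, decreases along
both variants as soon as every agent has been active, and dominates the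
objective. Hence the increments of x and of the y_i vanish along every path.

That is not enough for consensus, because the gaps between successive visits of
an agent are unbounded. On the event that |x - y_i| >= eps infinitely often,
irreducibility provides a fixed lag m such that, almost surely, infinitely often
|x^{k+1} - y_i^{k+1}| >= eps and i is active at time k + m. Activity of i forces
|x - y_i| to be small just after time k + m, and over the m steps in between x
and y_i move by o(1): a contradiction. Finally, the subgradient inequality
satisfied by each proximal step passes to the limit.
*)
Require Import Defs.
From HB Require Import structures.
From mathcomp Require Import all_boot all_order all_algebra.
From mathcomp Require Import all_classical all_reals all_analysis.
From mathcomp Require Import ring lra.
Import Order.TTheory GRing.Theory Num.Theory.
Import numFieldNormedType.Exports.
Local Open Scope classical_set_scope.
Local Open Scope ring_scope.

Set Implicit Arguments.
Unset Strict Implicit.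
Unset Printing Implicit Defensive.

(** * Euclidean geometry of row vectors *)

Section inner_product.
Context {R : realType} {p : nat}.
Implicit Types (u v w : 'rV[R]_p) (a : R).

Lemma dotpC u v : dotp u v = dotp v u.
Proof. by apply: eq_bigr => j _; rewrite mulrC. Qed.

Lemma dotpDl u v w : dotp (u + v) w = dotp u w + dotp v w.
Proof. by rewrite -big_split; apply: eq_bigr => j _; rewrite mxE mulrDl. Qed.

Lemma dotpZl a u v : dotp (a *: u) v = a * dotp u v.
Proof. by rewrite mulr_sumr; apply: eq_bigr => j _; rewrite mxE mulrA. Qed.

Lemma dotpNl u v : dotp (- u) v = - dotp u v.
Proof. by rewrite -scaleN1r dotpZl mulN1r. Qed.

Lemma dotpBl u v w : dotp (u - v) w = dotp u w - dotp v w.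
Proof. by rewrite dotpDl dotpNl. Qed.

Lemma dotpDr u v w : dotp w (u + v) = dotp w u + dotp w v.
Proof. by rewrite dotpC dotpDl !(dotpC w). Qed.

Lemma dotpZr a u v : dotp u (a *: v) = a * dotp u v.
Proof. by rewrite dotpC dotpZl dotpC. Qed.

Lemma dotpNr u v : dotp u (- v) = - dotp u v.
Proof. by rewrite dotpC dotpNl dotpC. Qed.

Definition dotpE := (dotpDl, dotpDr, dotpNl, dotpNr, dotpZl, dotpZr).

Lemma dotpp_ge0 u : 0 <= dotp u u.
Proof. by apply: sumr_ge0 => j _; rewrite -expr2 sqr_ge0. Qed.

Lemma enorm_ge0 u : 0 <= enorm u.
Proof. exact: sqrtr_ge0. Qed.

Lemma enorm_sqr u : enorm u ^+ 2 = dotp u u.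
Proof. by rewrite sqr_sqrtr// dotpp_ge0. Qed.

Lemma enorm_eq0 u : (enorm u == 0) = (u == 0).
Proof.
apply/eqP/eqP => [u0|->]; last first.
  by rewrite /enorm /dotp big1 ?sqrtr0// => j _; rewrite mxE mul0r.
have /eqP : dotp u u = 0 by rewrite -enorm_sqr u0 expr0n.
rewrite psumr_eq0 => [/allP h|j _]; last by rewrite -expr2 sqr_ge0.
apply/rowP => j; rewrite mxE; apply/eqP.
by move: (h j (mem_index_enum _)); rewrite /= mulf_eq0 orbb.
Qed.

Lemma enorm0 : enorm (0 : 'rV[R]_p) = 0.
Proof. by apply/eqP; rewrite enorm_eq0. Qed.

Lemma enormZ a u : enorm (a *: u) = `|a| * enorm u.
Proof.
by rewrite /enorm !dotpE mulrA -expr2 sqrtrM ?sqr_ge0// sqrtr_sqr.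
Qed.

Lemma enormN u : enorm (- u) = enorm u.
Proof. by rewrite -scaleN1r enormZ normrN1 mul1r. Qed.

Lemma enorm_distC u v : enorm (u - v) = enorm (v - u).
Proof. by rewrite -opprB enormN. Qed.

(** Cauchy-Schwarz: the squared norm of [enorm v *: u - enorm u *: v] equals
    [2 |u| |v| (|u| |v| - <u, v>)]. *)
Lemma dotp_le u v : dotp u v <= enorm u * enorm v.
Proof.
have [/eqP|v0] := eqVneq (enorm v) 0.
  rewrite enorm_eq0 => /eqP ->.
  by rewrite enorm0 mulr0 -(scale0r 0) dotpZr mul0r.
have v_gt0 : 0 < enorm v by rewrite lt_neqAle eq_sym v0 enorm_ge0.
have := dotpp_ge0 (enorm v *: u - enorm u *: v).
rewrite !dotpE (dotpC v u) -!enorm_sqr => h.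
have [/eqP|u0] := eqVneq (enorm u) 0.
  rewrite enorm_eq0 => /eqP ->.
  by rewrite enorm0 mul0r -(scale0r 0) dotpZl mul0r.
have u_gt0 : 0 < enorm u by rewrite lt_neqAle eq_sym u0 enorm_ge0.
rewrite -(ler_pM2l (mulr_gt0 u_gt0 v_gt0)).
nra.
Qed.

Lemma enormD u v : enorm (u + v) <= enorm u + enorm v.
Proof.
rewrite -(@ler_pXn2r _ 2)// ?nnegrE ?addr_ge0 ?enorm_ge0//.
rewrite enorm_sqr !dotpE (dotpC v u) -!enorm_sqr sqrrD.
have := dotp_le u v; lra.
Qed.

Lemma enormB u v : enorm (u - v) <= enorm u + enorm v.
Proof. by rewrite (le_trans (enormD _ _))// enormN. Qed.

Lemma normr_coord_le u j : `|u 0 j| <= enorm u.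
Proof.
rewrite -sqrtr_sqr ler_sqrt ?dotpp_ge0//.
rewrite /dotp (bigD1 j)//= -expr2 lerDl.
by apply: sumr_ge0 => k _; rewrite -expr2 sqr_ge0.
Qed.

Lemma enorm_continuous : continuous (@enorm R p).
Proof.
move=> u; apply: continuous_comp; last exact: sqrt_continuous.
have h : continuous (fun u : 'rV[R]_p => \sum_(j < p) u 0 j * u 0 j).
  apply: continuous_big => [|j _ x]; first exact: add_continuous.
  by apply: (@continuousM R) => ?; exact: coord_continuous.
exact: h.
Qed.

Lemma normr_le_enorm u : `|u| <= enorm u.
Proof.
rewrite [`|u|]mx_normrE; apply: bigmax_le; first exact: enorm_ge0.
by move=> [i j] _ /=; rewrite (ord1 i) normr_coord_le.
Qed.

Lemma dotp_sumr (I : finType) (F : I -> 'rV[R]_p) u :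
  dotp u (\sum_i F i) = \sum_i dotp u (F i).
Proof.
elim/big_rec2: _ => [|i a b _ <-]; last by rewrite dotpDr.
by rewrite -(scale0r 0) dotpZr mul0r.
Qed.

Lemma enorm_sum (I : finType) (F : I -> 'rV[R]_p) :
  enorm (\sum_i F i) <= \sum_i enorm (F i).
Proof.
elim/big_rec2: _ => [|i a b _ h]; first by rewrite enorm0.
by rewrite (le_trans (enormD _ _))// lerD2l.
Qed.

End inner_product.

(** * Vanishing sequences *)

Section vanishing.
Context {R : realType} {p : nat}.
Implicit Types (u v : nat -> 'rV[R]_p).

Definition vanishing u := forall e : R, 0 < e ->
  exists K, forall k, (K <= k)%N -> enorm (u k) < e.

Lemma vanishing_le (C : R) K u v : vanishing u ->
  (forall k, (K <= k)%N -> enorm (v k) <= C * enorm (u k)) -> vanishing v.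
Proof.
move=> u0 h e e0; have C0 : 0 < `|C| + 1 by rewrite ltr_wpDl.
have [K' hK'] := u0 (e / (`|C| + 1)) (divr_gt0 e0 C0).
exists (maxn K K') => k; rewrite geq_max => /andP[Kk /hK'].
rewrite ltr_pdivlMr// => hu; apply: le_lt_trans (h k Kk) _.
apply: le_lt_trans hu; rewrite mulrC ler_wpM2l ?enorm_ge0//.
by have := ler_norm C; lra.
Qed.

Lemma vanishingD u v : vanishing u -> vanishing v -> vanishing (fun k => u k + v k).
Proof.
move=> u0 v0 e e0; have e2 : 0 < e / 2 by lra.
have [K hK] := u0 _ e2; have [K' hK'] := v0 _ e2.
exists (maxn K K') => k; rewrite geq_max => /andP[/hK ? /hK' ?].
by apply: le_lt_trans (enormD _ _) _; lra.
Qed.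

Lemma vanishingZ (a : R) u : vanishing u -> vanishing (fun k => a *: u k).
Proof.
by move=> u0; apply: (@vanishing_le `|a| 0 u) => // k _; rewrite enormZ.
Qed.

Lemma vanishingB u v : vanishing u -> vanishing v -> vanishing (fun k => u k - v k).
Proof.
move=> u0 /(vanishingZ (-1)) v0 e e0.
have [K hK] := vanishingD u0 v0 e0.
by exists K => k /hK; rewrite scaleN1r.
Qed.

Lemma vanishing_sum (I : finType) (u : I -> nat -> 'rV[R]_p) :
  (forall i, vanishing (u i)) -> vanishing (fun k => \sum_i u i k).
Proof.
move=> h; have : forall r : seq I, vanishing (fun k => \sum_(i <- r) u i k).
  elim=> [|i l IH].
    by move=> e e0; exists 0%N => k _; rewrite big_nil enorm0.
  move=> e e0; have [K hK] := vanishingD (h i) IH e0.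
  by exists K => k /hK; rewrite big_cons.
exact.
Qed.

Lemma vanishing_shift m u : vanishing u -> vanishing (fun k => u (k + m)%N).
Proof.
move=> u0 e /u0[K hK]; exists K => k Kk.
by apply: hK; rewrite (leq_trans Kk)// leq_addr.
Qed.

(** The lag [m] is fixed, so the difference is a sum of [m] vanishing increments; an unbounded lag
    would not do. *)
Lemma vanishing_increment m u : vanishing (fun k => u k.+1 - u k) ->
  vanishing (fun k => u (k + m)%N - u k).
Proof.
move=> du; elim: m => [|m IH].
  by move=> e e0; exists 0%N => k _; rewrite addn0 subrr enorm0.
move=> e e0; have [K hK] := vanishingD (vanishing_shift m du) IH e0.
by exists K => k /hK; rewrite addnS addrA subrK.
Qed.

(** From [K] on, [a] is nonincreasing and bounded below, so it converges; two consecutive values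
    within [c e^2 / 2] of the limit force [enorm (u k) < e]. *)
Lemma vanishing_descent (a : nat -> R) u (m c : R) K : 0 < c ->
  (forall k, (K <= k)%N -> m <= a k) ->
  (forall k, (K <= k)%N -> c * enorm (u k) ^+ 2 <= a k - a k.+1) ->
  vanishing u.
Proof.
move=> c0 ma da.
have : cvgn (fun k => a (k + K)%N).
  apply: nonincreasing_is_cvgn.
    apply/nonincreasing_seqP => k; rewrite addSn -subr_ge0.
    apply: le_trans (da _ (leq_addl _ _)).
    by rewrite mulr_ge0 ?sqr_ge0 ?ltW.
  by exists m => _ [k _ <-]; exact/ma/leq_addl.
move=> /cvgrPdist_lt cv e e0.
have d0 : 0 < c * e ^+ 2 / 2 by rewrite divr_gt0// mulr_gt0// exprn_gt0.
have [N _ hN] := cv _ d0; exists (N + K)%N => k NKk.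
have Kk : (K <= k)%N by apply: leq_trans NKk; exact: leq_addl.
have h1 := hN (k - K)%N; have h2 := hN (k - K).+1.
rewrite /= leq_subRL// addnC NKk subnK// in h1.
rewrite /= addSn subnK// in h2.
have {}h1 := h1 isT.
have {}h2 : `|limn (fun k => a (k + K)%N) - a k.+1| < c * e ^+ 2 / 2.
  by apply: h2; rewrite leqW// leq_subRL// addnC.
have := da k Kk; move: h1 h2; rewrite !ltr_norml => /andP[h1 h2] /andP[h3 h4] h5.
have : c * enorm (u k) ^+ 2 < c * e ^+ 2 by lra.
by rewrite ltr_pM2l// ltr_pXn2r ?nnegrE ?enorm_ge0// ltW.
Qed.

End vanishing.

(** * Smooth functions and proximal points *)

Section smooth.
Context {R : realType} {p : nat}.
Implicit Types (u v w : 'rV[R]_p) (f : 'rV[R]_p -> R).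

Lemma derive_grad f v w : differentiable f v -> 'D_w f v = dotp (grad f v) w.
Proof.
move=> df; rewrite deriveE// {1}(row_sum_delta w) linear_sum /=.
apply: eq_bigr => j _; rewrite linearZ /= mxE -deriveE//.
by rewrite mulrC.
Qed.

Lemma is_derive_line f v w t : differentiable f (v + t *: w) ->
  is_derive t 1 (fun s : R => f (v + s *: w)) (dotp (grad f (v + t *: w)) w).
Proof.
move=> df.
(* The directional difference quotient of [f] and that of its restriction to the line are the same
   function. *)
have E : (fun h : R => h^-1 *: ((f \o shift (v + t *: w)) (h *: w) - f (v + t *: w)))
   = (fun h => h^-1 *: (((fun s : R => f (v + s *: w)) \o shift t) (h *: (1:R)) -
        f (v + t *: w))).
  apply/funext => h /=; congr (_ *: (f _ - _)).
  by rewrite scalerDl -[h%:A]/(h * 1) mulr1 [RHS]addrCA.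
split; first by rewrite /derivable -E; exact: diff_derivable.
by rewrite -derive_grad// /derive -E.
Qed.

(** Descent lemma. [psi] is [f] on the segment minus its linear and quadratic terms; by the
    Lipschitz bound its derivative is nonpositive there, and the mean value theorem compares its end
    values. *)
Lemma grad_upper (L : R) f u v : lipschitz_differentiable L f ->
  f u <= f v + dotp (grad f v) (u - v) + L / 2 * enorm (u - v) ^+ 2.
Proof.
move=> [df lf]; set w := u - v.
pose D t := dotp (grad f (v + t *: w)) w.
pose psi (t : R) := f (v + t *: w) - t * dotp (grad f v) w
  - t ^+ 2 * (L / 2 * enorm w ^+ 2).
have dpsi (t : R) : is_derive t (1 : R) psi
    (D t - dotp (grad f v) w - t * (L * enorm w ^+ 2)).
  have h := is_derive_line (df (v + t *: w)).
  apply: is_derive_eq.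
  rewrite -/(D t) /GRing.scale /= !(mulr0, mulr1, add0r, addr0) /D.
  by field.
have cpsi : {within `[0, 1], continuous psi}.
  apply: derivable_within_continuous => t _; exact: ex_derive.
have [t] := @MVT _ psi _ 0 1 ltr01 (fun t _ => dpsi t) cpsi.
rewrite in_itv /= => /andP[t0 t1].
have -> : psi 0 = f v by rewrite /psi scale0r addr0 mul0r expr0n mul0r !subr0.
have -> : psi 1 = f u - dotp (grad f v) w - L / 2 * enorm w ^+ 2.
  by rewrite /psi scale1r expr1n !mul1r /w [v + _]addrC subrK.
rewrite subr0 mulr1 => E.
suff : D t - dotp (grad f v) w <= t * (L * enorm w ^+ 2) by nra.
rewrite /D -dotpBl (le_trans (dotp_le _ _))//.
have := lf (v + t *: w) v; rewrite addrAC subrr add0r enormZ gtr0_norm// => h.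
have := enorm_ge0 w; nra.
Qed.

Lemma lipschitz_differentiableN (L : R) f : lipschitz_differentiable L f ->
  lipschitz_differentiable L (fun u => - f u).
Proof.
move=> [df lf]; have g u : grad (fun u => - f u) u = - grad f u.
  by apply/rowP => j; rewrite !mxE deriveN//; exact: diff_derivable.
split=> [u|u v]; first exact: differentiableN.
by rewrite !g -opprD enormN lf.
Qed.

Lemma grad_lower (L : R) f u v : lipschitz_differentiable L f ->
  f v + dotp (grad f v) (u - v) - L / 2 * enorm (u - v) ^+ 2 <= f u.
Proof.
move=> lf; have := grad_upper u v (lipschitz_differentiableN lf).
have -> : grad (fun u => - f u) v = - grad f v.
  by apply/rowP => j; rewrite !mxE deriveN//; apply: diff_derivable; case: lf.
by rewrite dotpNl; lra.
Qed.

End smooth.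

(** Serves to let [t] tend to 0 once a convexity inequality has been divided by [t]. If [a > 0], the
    choice [t = a / (a + |c| + 1)] gives [a + |c| + 1 <= c]. *)
Lemma le0_of_small_multiples {R : realFieldType} (a c : R) :
  (forall t, 0 < t < 1 -> a <= t * c) -> a <= 0.
Proof.
move=> h; rewrite leNgt; apply/negP => a0.
have D0 : 0 < a + `|c| + 1 by rewrite ltr_wpDl// addr_ge0// ltW.
have /h : 0 < a / (a + `|c| + 1) < 1.
  by rewrite divr_gt0//= ltr_pdivrMr// mul1r; have := normr_ge0 c; lra.
rewrite mulrAC ler_pdivlMr//; apply/negP; rewrite -ltNge.
by rewrite ltr_pM2l//; have := ler_norm c; lra.
Qed.

(** * Semiconvex functions: proximal points, subgradients and their limits *)

Section variational.
Context {R : realType} {p : nat}.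
Implicit Types (u v w x y d : 'rV[R]_p) (h r : 'rV[R]_p -> \bar R).

Lemma enorm_sqr_convex t u v :
  enorm (t *: u + (1 - t) *: v) ^+ 2 =
  t * enorm u ^+ 2 + (1 - t) * enorm v ^+ 2 - t * (1 - t) * enorm (u - v) ^+ 2.
Proof. by rewrite !enorm_sqr !dotpE (dotpC v u); ring. Qed.

Lemma enorm_sqr_shift u v w :
  enorm (u - v) ^+ 2 =
  enorm (u - w) ^+ 2 + enorm (w - v) ^+ 2 + 2 * dotp (w - v) (u - w).
Proof.
by rewrite !enorm_sqr !dotpE (dotpC v u) (dotpC w u) (dotpC w v); ring.
Qed.

Lemma near_enorm_lt x (e : R) : 0 < e -> \forall y \near x, enorm (y - x) < e.
Proof.
move=> e0.
have c : continuous (fun y : 'rV[R]_p => enorm (y - x)).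
  move=> y; apply: continuous_comp; last exact: enorm_continuous.
  by apply: continuousB => //; exact: cst_continuous.
have := c x; rewrite /continuous_at subrr enorm0 => /cvgrPdist_lt /(_ e e0).
apply: filterS => y /=; rewrite sub0r normrN; apply: le_lt_trans.
exact: ler_norm.
Qed.

(** The global subgradient inequality of semiconvex functions. Involving only values, it passes to
    limits, and it implies membership in the limiting subdifferential. *)
Definition semi_subgradient (gamma : R) r x d : Prop :=
  r x \is a fin_num /\ forall u,
    (r x + (dotp d (u - x) - gamma / 2 * enorm (u - x) ^+ 2)%:E <= r u)%E.

Section prox.
Variables (r : 'rV[R]_p -> \bar R) (gamma beta : R).
Hypotheses (hr : forall x, r x != -oo%E) (beta0 : 0 < beta).

Lemma prox_fin_num v x : prox beta^-1 r v x -> r x \is a fin_num.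
Proof. by case=> h _; rewrite fin_numE hr; move: h; case: (r x). Qed.

(** The function minimized by the proximal operator is strongly convex with modulus [beta - gamma]
    (of either sign): compare [x] with a point of the segment to [u], divide by [t] and let [t] tend
    to 0. *)
Lemma prox_strong v x u : semiconvex gamma r -> prox beta^-1 r v x ->
  r u \is a fin_num ->
  fine (r x) + beta / 2 * enorm (x - v) ^+ 2
    + (beta - gamma) / 2 * enorm (u - x) ^+ 2
  <= fine (r u) + beta / 2 * enorm (u - v) ^+ 2.
Proof.
move=> sc hx ru; have rx := prox_fin_num hx; case: hx => _ xmin.
rewrite -subr_le0.
apply: (@le0_of_small_multiples _ _ ((beta - gamma) / 2 * enorm (u - x) ^+ 2)).
move=> t /andP[t0 t1]; set w := t *: u + (1 - t) *: x.
have tI : 0 <= t <= 1 by rewrite !ltW.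
have hw := sc u x t tI; have := xmin w; rewrite /= -/w in hw *.
have -> : (2 * beta^-1)^-1 = beta / 2 by field; rewrite gt_eqF.
have rw : r w \is a fin_num.
  rewrite fin_numE hr; apply: contraTN hw => /eqP ->.
  by rewrite -(fineK rx) -(fineK ru).
move: hw; rewrite -(fineK rx) -(fineK ru) -(fineK rw) -!EFinD !lee_fin.
rewrite (_ : w - v = t *: (u - v) + (1 - t) *: (x - v)); last first.
  by rewrite !scalerBr addrACA -opprD -scalerDl subrKC scale1r.
rewrite {2}/w !enorm_sqr_convex.
rewrite (_ : u - v - (x - v) = u - x); last by rewrite opprB addrA subrK.
set A := fine (r x); set B := fine (r u); set C := fine (r w).
set Nu := enorm u ^+ 2; set Nx := enorm x ^+ 2; set D := enorm (u - x) ^+ 2.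
set E := enorm (u - v) ^+ 2; set F := enorm (x - v) ^+ 2 => h1 h2.
rewrite -(ler_pM2l t0) /=; lra.
Qed.

(** Expanding [|u - v|^2] around [x] in [prox_strong] cancels the terms in [beta |u - x|^2] and
    leaves the error with factor [gamma / 2]. *)
Lemma prox_semi_subgradient v x : semiconvex gamma r -> prox beta^-1 r v x ->
  semi_subgradient gamma r x (beta *: (v - x)).
Proof.
move=> sc hx; split; first exact: prox_fin_num hx.
move=> u; have [ru|] := boolP (r u \is a fin_num); last first.
  rewrite fin_numE negb_and !negbK (negbTE (hr u)) /= => /eqP ->.
  by rewrite leey.
have := prox_strong sc hx ru.
rewrite -[r x]fineK ?(prox_fin_num hx)// -[r u]fineK// -EFinD lee_fin.
rewrite (enorm_sqr_shift u v x) -(opprB x v) scalerN dotpNl dotpZl.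
lra.
Qed.

(** The growth inequalities at [x] and [x'] add up to [(beta - gamma) |x - x'|^2 <= 0]. *)
Lemma prox_unique v x x' : gamma < beta -> semiconvex gamma r ->
  prox beta^-1 r v x -> prox beta^-1 r v x' -> x = x'.
Proof.
move=> gb sc hx hx'.
have h1 := prox_strong sc hx (prox_fin_num hx').
have h2 := prox_strong sc hx' (prox_fin_num hx).
rewrite (enorm_distC x' x) in h1.
apply/eqP; rewrite -subr_eq0 -enorm_eq0 -sqrf_eq0 eq_le sqr_ge0 andbT.
nra.
Qed.

End prox.

(** First-order optimality by a test step: [w] is minus the gradient of the proximal objective,
    which is [(L + beta)]-smooth, so the step [w / (L + beta)] would lower it by at least
    [|w|^2 / (2 (L + beta))]. *)
Lemma prox_smooth (L beta : R) f v y : 0 <= L -> 0 < beta ->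
  lipschitz_differentiable L f -> prox beta^-1 (fun u => (f u)%:E) v y ->
  grad f y = beta *: (v - y).
Proof.
move=> L0 b0 lf [_ ymin].
apply/eqP; rewrite -subr_eq0 -oppr_eq0; set w := - _.
have Lb : 0 < L + beta by lra.
have := ymin (y + (L + beta)^-1 *: w); rewrite /= -!EFinD lee_fin.
have -> : (2 * beta^-1)^-1 = beta / 2 by field; rewrite gt_eqF.
have := grad_upper (y + (L + beta)^-1 *: w) y lf.
rewrite (enorm_sqr_shift (y + _) v y) [y + _ - y]addrAC subrr add0r enormZ.
rewrite gtr0_norm ?invr_gt0// !dotpZr.
have : dotp (grad f y) w + beta * dotp (y - v) w = - enorm w ^+ 2.
  rewrite enorm_sqr -dotpZl -dotpDl -dotpNl; congr (dotp _ _).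
  by rewrite /w opprK -(opprB y v) scalerN opprK.
set a := dotp (grad f y) w; set b := dotp (y - v) w; set N := enorm w.
move=> e h1 h2; rewrite -enorm_eq0 -/N -sqrf_eq0 eq_le sqr_ge0 andbT.
set s := (L + beta)^-1 in h1 h2.
have s0 : 0 < s by rewrite invr_gt0.
have sE : s * (L + beta) = 1 by rewrite mulVf ?gt_eqF.
have : 0 <= s * (a + beta * b) + (s * (L + beta)) * s * N ^+ 2 / 2 by nra.
rewrite sE e; nra.
Qed.

Section limit.
Variables (r : 'rV[R]_p -> \bar R) (gamma : R).
Hypothesis hr : forall x, r x != -oo%E.

(** By lower semicontinuity any [a] below [r x] is below [r x'] for [x'] near [x]; the inequality at
    [x'] then bounds [a] up to an error of order [t]. *)
Lemma semi_subgradient_closed x d : lower_semicontinuous r ->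
  (forall e : R, 0 < e -> exists x' d', [/\ enorm (x' - x) < e,
     enorm (d' - d) < e & semi_subgradient gamma r x' d']) ->
  semi_subgradient gamma r x d.
Proof.
move=> lsc H.
have key u a : r u \is a fin_num -> (a%:E < r x)%E ->
    a <= fine (r u) - dotp d (u - x) + gamma / 2 * enorm (u - x) ^+ 2.
  move=> ru ax; have [V Vx aV] := lsc x a ax.
  have /nbhs_ballP[e0 /= e00 eV] := Vx.
  (* [t] will bound both [|x' - x|] and [|d' - d|]. The factor collects the errors estimated in
     [E8], [E9] and [E7]. *)
  rewrite -subr_le0; apply: (@le0_of_small_multiples _ _
    (enorm (u - x) + 1 + enorm d + `|gamma| / 2 * (2 * enorm (u - x) + 1))).
  move=> t /andP[t0 t1].
  have [|x' [d' [hx' hd' [rx' sub]]]] := H (Num.min t e0).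
    by rewrite lt_min t0 e00.
  move: hx' hd'; rewrite !lt_min => /andP[x't x'e] /andP[d't _].
  have /aV : V x'.
    apply: eV; rewrite -ball_normE /=.
    by rewrite (le_lt_trans (normr_le_enorm _))// enorm_distC.
  have := sub u; rewrite -(fineK rx') -(fineK ru) -EFinD lee_fin lte_fin.
  have E1 : dotp d' (u - x') =
      dotp d (u - x) + dotp (d' - d) (u - x') - dotp d (x' - x).
    by rewrite !dotpE; ring.
  have E2 := enorm_sqr_shift u x x'.
  have E3 := dotp_le (- (d' - d)) (u - x'); rewrite dotpNl enormN in E3.
  have E4 := dotp_le d (x' - x).
  have E5 : enorm (u - x') <= enorm (u - x) + enorm (x' - x).
    have -> : u - x' = (u - x) - (x' - x) by rewrite opprB addrA subrK.
    exact: enormB.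
  have E6 : enorm (u - x) <= enorm (u - x') + enorm (x' - x).
    have -> : u - x = (u - x') + (x' - x) by rewrite addrA subrK.
    exact: enormD.
  have n1 := enorm_ge0 (u - x'); have n2 := enorm_ge0 (x' - x).
  have n3 := enorm_ge0 (u - x); have n4 := enorm_ge0 d.
  have n5 := enorm_ge0 (d' - d).
  have E7 : gamma * (enorm (u - x') ^+ 2 - enorm (u - x) ^+ 2) <=
      `|gamma| * (t * (2 * enorm (u - x) + 1)).
    rewrite (le_trans (ler_norm _))// normrM ler_wpM2l// ler_norml; nra.
  have E8 : enorm (d' - d) * enorm (u - x') <= t * (enorm (u - x) + 1) by nra.
  have E9 : enorm d * enorm (x' - x) <= enorm d * t.
    by rewrite ler_wpM2l// ltW.
  move=> h1 h2.
  rewrite E1 in h1; nra.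
have rx : r x \is a fin_num.
  (* If [r x] were infinite, [key] would apply to every real [a], which fails for [u = x'] with
     [r x'] finite. *)
  rewrite fin_numE hr; apply/negP => /eqP rx.
  have [x' [d' [_ _ [rx' _]]]] := H 1 ltr01.
  have := key x' (fine (r x') - dotp d (x' - x)
    + gamma / 2 * enorm (x' - x) ^+ 2 + 1) rx'.
  by rewrite rx ltry => /(_ isT); lra.
split=> // u; have [ru|] := boolP (r u \is a fin_num); last first.
  rewrite fin_numE negb_and !negbK (negbTE (hr u)) /= => /eqP ->.
  by rewrite leey.
rewrite -(fineK rx) -(fineK ru) -EFinD lee_fin.
apply/ler_addgt0Pr => e e0.
have h : ((fine (r x) - e)%:E < r x)%E.
  by rewrite -[X in (_ < X)%E]fineK// lte_fin ltrBlDr ltrDl.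
have := key u _ ru h; lra.
Qed.

(** Such a [d] is even a regular subgradient, as the quadratic error is at most [e |y - x|] within
    radius [e / (|gamma| + 1)]; constant sequences then do. *)
Lemma semi_subgradient_limiting x d : semi_subgradient gamma r x d ->
  limiting_subdiff r x d.
Proof.
move=> [rx sub]; split=> //; exists (fun=> x), (fun=> d).
split; [exact: cvg_cst|exact: cvg_cst|move=> _|exact: cvg_cst].
split=> // e e0.
have e1 : 0 < e / (`|gamma| + 1) by rewrite divr_gt0// ltr_wpDl.
apply: filterS (near_enorm_lt x e1) => y; rewrite ltr_pdivlMr ?ltr_wpDl// => h.
apply: le_trans (sub y); apply: leeD => //; rewrite lee_fin lerB//.
have n := enorm_ge0 (y - x); have g := ler_norm gamma.
have : gamma * enorm (y - x) ^+ 2 <= `|gamma| * enorm (y - x) ^+ 2.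
  by rewrite ler_wpM2r// sqr_ge0.
have := normr_ge0 gamma; nra.
Qed.

End limit.
End variational.

(** * Stationary points and minimizers of the objective *)

Section optimality.
Context {R : realType} {n p : nat}.
Implicit Types (u x d : 'rV[R]_p).

(** At [x + t (u - x)] the error is [C t^2 |u - x|^2], while convexity bounds the increase of [h] by
    [t (h u - h x)]; divide by [t] and let [t] tend to 0. *)
Lemma convex_argmin (h : 'rV[R]_p -> \bar R) (C : R) x :
  convex_ext h -> h x \is a fin_num ->
  (forall u, (h x + (- (C * enorm (u - x) ^+ 2))%:E <= h u)%E) ->
  argmin h x.
Proof.
move=> cvx hx low; split; first by rewrite ltey_eq hx.
move=> u; have hN w : h w != -oo%E.
  by apply: contraTN (low w) => /eqP ->; rewrite -(fineK hx).
have [hu|] := boolP (h u \is a fin_num); last first.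
  rewrite fin_numE negb_and !negbK (negbTE (hN u)) /= => /eqP ->.
  by rewrite leey.
rewrite -(fineK hx) -(fineK hu) lee_fin -subr_le0.
apply: (@le0_of_small_multiples _ _ (C * enorm (u - x) ^+ 2)).
move=> t /andP[t0 t1]; set w := t *: u + (1 - t) *: x.
have lw := low w; have tI : 0 <= t <= 1 by rewrite !ltW.
have hw := cvx u x t tI; rewrite -/w in hw.
have := le_trans lw hw.
rewrite -(fineK hx) -(fineK hu) -!EFinD lee_fin.
have -> : w - x = t *: (u - x).
  by rewrite /w scalerBl scale1r scalerBr addrCA (addrC x) addrK.
rewrite enormZ gtr0_norm//= => h1; rewrite -(ler_pM2l t0); lra.
Qed.

Variables (r : 'rV[R]_p -> \bar R) (f : 'I_n -> 'rV[R]_p -> R) (L gamma : R).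
Hypothesis lf : forall i, lipschitz_differentiable L (f i).

Lemma semi_subgradient_stationary x :
  semi_subgradient gamma r x (- (n%:R^-1 *: \sum_(i < n) grad (f i) x)) ->
  stationary r f x.
Proof.
move=> /semi_subgradient_limiting sub.
by exists (- (n%:R^-1 *: \sum_(i < n) grad (f i) x)) => //; rewrite addNr.
Qed.

(** Convexity is available for the sum only. The inequality for [r] and the lower bounds for the
    [f i] show minimality up to a quadratic error, which [convex_argmin] removes. *)
Lemma semi_subgradient_argmin x :
  semi_subgradient gamma r x (- (n%:R^-1 *: \sum_(i < n) grad (f i) x)) ->
  convex_ext (objective r f) -> argmin (objective r f) x.
Proof.
move=> [rx sub] cvx.
pose C := gamma / 2 + n%:R^-1 * \sum_(i < n) (L / 2).
apply: (@convex_argmin _ C) => //; first by rewrite fin_numD rx.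
move=> u; apply: le_trans (leeD (sub u) (lexx _)).
rewrite -!addeA leeD2l// -!EFinD lee_fin dotpNl dotpZl.
have -> : dotp (\sum_(i < n) grad (f i) x) (u - x) =
    \sum_(i < n) dotp (grad (f i) x) (u - x).
  by rewrite dotpC dotp_sumr; apply: eq_bigr => i _; rewrite dotpC.
have h : \sum_(i < n) (f i x + dotp (grad (f i) x) (u - x) -
    L / 2 * enorm (u - x) ^+ 2) <= \sum_(i < n) f i u.
  by apply: ler_sum => i _; exact: grad_lower.
rewrite sumrB big_split /= -mulr_suml in h.
have n0 : 0 <= (n%:R : R)^-1 by rewrite invr_ge0.
rewrite /C; nra.
Qed.

End optimality.

(** * Recurrence in irreducible Markov chains *)

Section recurrence.
Context {R : realType} {n : nat} {d : measure_display} {Omega : measurableType d}.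
Variables (Pr : probability Omega R) (P : 'M[R]_n) (s : nat -> Omega -> 'I_n).
Hypotheses (P_stochastic : stochastic P) (s_markov : markov_chain Pr P s).
Implicit Types (B : set Omega) (E : nat -> set Omega) (a : nat -> 'I_n).

Definition agree (k : nat) (w w' : Omega) :=
  forall m, (m <= k)%N -> s m w = s m w'.

(** The events generated by the states up to time [k], described by paths rather than by a
    sigma-algebra. *)
Definition determined (k : nat) B := forall w w', agree k w w' -> B w -> B w'.

Definition infinitely_often E (w : Omega) :=
  forall K, exists2 k, (K <= k)%N & E k w.

Let cyl (k : nat) a : set Omega := [set w | forall m, (m <= k)%N -> s m w = a m].

Let upd k a c := fun m => if m == k then c else a m.

Let pr B := fine (Pr B).

Let measurable_state k c : measurable (s k @^-1` [set c]).
Proof. by case: s_markov. Qed.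

Let measurable_cyl k a : measurable (cyl k a).
Proof.
have -> : cyl k a = \bigcap_(m in `I_k.+1) (s m @^-1` [set a m]).
  by apply/seteqP; split=> w h m; apply: h.
by apply: bigcap_measurable => //; exists 0%N.
Qed.

(** There are finitely many words of length [k + 1], so [B] is a finite union of cylinders that meet
    it. This provides the measurability of events defined by the iterates. *)
Lemma measurable_determined k B : determined k B -> measurable B.
Proof.
move=> dB; pose a (t : {ffun 'I_k.+1 -> 'I_n}) := fun m => t (inord m).
pose D : {pred {ffun 'I_k.+1 -> 'I_n}} :=
  fun t => `[<exists2 w, B w & cyl k (a t) w>].
have -> : B = \bigcup_(t in [set` D]) cyl k (a t).
  apply/seteqP; split => [w Bw|w [t /asboolP[w' Bw' w't] wt]]; last first.
    by apply: (dB w') => // m mk; rewrite w't// wt.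
  have wt : cyl k (a [ffun m : 'I_k.+1 => s m w]) w.
    by move=> m mk; rewrite /a ffunE inordK.
  by exists [ffun m : 'I_k.+1 => s m w] => //; apply/asboolP; exists w.
by rewrite bigcup_pred; apply: bigsetU_measurable.
Qed.

Let pr_ge0 B : 0 <= pr B.
Proof. exact/fine_ge0/measure_ge0. Qed.

Let prK B : measurable B -> (pr B)%:E = Pr B.
Proof. by move=> mB; rewrite fineK// fin_num_measure. Qed.

Let pr_le B B' : measurable B -> measurable B' -> B `<=` B' -> pr B <= pr B'.
Proof.
by move=> mB mB' BB'; rewrite -lee_fin !prK// le_measure// inE.
Qed.

Let pr_split (F : 'I_n -> set Omega) B :
  (forall i, measurable (F i)) -> (forall i j w, F i w -> F j w -> i = j) ->
  measurable B -> (forall w, B w -> exists i, F i w) ->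
  pr B = \sum_i pr (F i `&` B).
Proof.
move=> mF dF mB cB; have mFB i : measurable (F i `&` B) by exact: measurableI.
apply: EFin_inj; rewrite prK// -sumEFin.
under eq_bigr do rewrite prK//.
rewrite -measure_bigsetU_ord//.
  congr (Pr _); rewrite -bigcup_pred; apply/seteqP; split => w.
    by move=> Bw; have [i Fi] := cB w Bw; exists i.
  by move=> [i _ []].
apply/trivIsetP => i j _ _ ij; apply/seteqP; split => // w [[Fi _] [Fj _]].
by move: ij; rewrite (dF _ _ _ Fi Fj) eqxx.
Qed.

Let cylS k a c w : cyl k.+1 (upd k.+1 a c) w <-> cyl k a w /\ s k.+1 w = c.
Proof.
split=> [h|[h e] m]; first split.
- by move=> m mk; rewrite h ?(leq_trans mk)// /upd ltn_eqF.
- by rewrite h// /upd eqxx.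
by rewrite leq_eqVlt /upd; case: eqVneq => [->|_]//=; exact: h.
Qed.

(** The Markov property as a product rule; for a null past, where the conditional probability says
    nothing, both sides vanish. *)
Let pr_cylS k a c : pr (cyl k.+1 (upd k.+1 a c)) = P (a k) c * pr (cyl k a).
Proof.
have -> : cyl k.+1 (upd k.+1 a c) = s k.+1 @^-1` [set c] `&` cyl k a.
  by apply/seteqP; split=> w; rewrite cylS; case.
have mI : measurable (s k.+1 @^-1` [set c] `&` cyl k a) by exact: measurableI.
have [c0|c0] := eqVneq (Pr (cyl k a)) 0%E.
  rewrite /pr c0 /= mulr0 (_ : Pr _ = 0%E)//.
  by apply: subset_measure0 c0 => //; exact: subIsetr.
have cp : (0 < Pr (cyl k a))%E by rewrite lt0e c0 measure_ge0.
case: s_markov => _ /(_ k a c cp) <-; rewrite /cond_prob -/(cyl k a).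
rewrite divfK//; apply: contra c0 => /eqP c0.
by rewrite -prK// /pr c0.
Qed.

Let pr_split_cyl k a B : measurable B ->
  pr (cyl k a `&` B) = \sum_c pr (cyl k.+1 (upd k.+1 a c) `&` B).
Proof.
move=> mB; rewrite (@pr_split (fun c => cyl k.+1 (upd k.+1 a c)))//.
- apply: eq_bigr => c _; congr pr; apply/seteqP.
  by split=> w /=; rewrite !cylS => -[[? ?]] // [].
- by move=> i j w /cylS[_ <-] /cylS[_ <-].
- exact: measurableI.
- by move=> w [cw _]; exists (s k.+1 w); apply/cylS.
Qed.

(** Cylinders of length [k + 1] are merged step by step into shorter ones, down to the states at
    time 0, which partition the space. *)
Let pr_cyl_le k B (l : R) : measurable B ->
  (forall a, pr (cyl k a `&` B) <= l * pr (cyl k a)) -> pr B <= l.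
Proof.
move=> mB; elim: k => [|k IH] h; last first.
  apply: IH => a; rewrite pr_split_cyl// -(setIT (cyl k a)) pr_split_cyl//.
  by rewrite mulr_sumr; apply: ler_sum => c _; rewrite setIT.
have c0 : forall w : Omega, True -> exists c, cyl 0 (fun=> c) w.
  by move=> w _; exists (s 0 w) => m; rewrite leqn0 => /eqP ->.
have dc i j w : cyl 0 (fun=> i) w -> cyl 0 (fun=> j) w -> i = j.
  by move=> /(_ 0 (leqnn _)) <- /(_ 0 (leqnn _)) <-.
rewrite (pr_split _ dc)//; last by move=> w _; exact: c0.
have <- : l * pr setT = l by rewrite /pr probability_setT mulr1.
rewrite (pr_split _ dc)// mulr_sumr; apply: ler_sum => c _.
by rewrite setIT.
Qed.

(* [miss b E M m k]: among the times in [[k, k + M)] at which [E] occurs there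
   are at least [m], and the first [m] of them are not followed by state [b]. *)
Fixpoint miss (b : 'I_n) E (M m k : nat) : set Omega :=
  match M, m with
  | _, 0 => setT
  | 0, _.+1 => set0
  | M'.+1, m'.+1 =>
      (~` E k `&` miss b E M' m k.+1) `|`
      ((E k `\` s k.+1 @^-1` [set b]) `&` miss b E M' m' k.+1)
  end.

Lemma measurable_miss b E M m k : (forall k, determined k (E k)) ->
  measurable (miss b E M m k).
Proof.
move=> dE; elim: M m k => [|M IH] [|m] k //=.
have mE := measurable_determined (dE k).
apply: measurableU; apply: measurableI => //; first exact: measurableC.
exact: measurableD.
Qed.

Lemma miss_homo b E m k :
  {homo (fun M => miss b E M m k) : M M' / (M <= M')%N >-> (M <= M')%O}.
Proof.
apply/nondecreasing_seqP => M; rewrite subsetEset.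
elim: M m k => [|M IH] [|m] k //= w.
by move=> [[Ek /IH h]|[Ek /IH h]]; [left|right].
Qed.

(** Whatever the past, an occurrence of [E] finds the chain in [c0] and is missed with probability
    [1 - P c0 b]; induction on the window, over all cylinders, multiplies these factors. *)
Lemma pr_miss_le (c0 b : 'I_n) E M m k a : (forall k, determined k (E k)) ->
  (forall k w, E k w -> s k w = c0) ->
  pr (cyl k a `&` miss b E M m k) <= (1 - P c0 b) ^+ m * pr (cyl k a).
Proof.
move=> dE Ea; have [P0 P1] := P_stochastic.
have q0 : 0 <= 1 - P c0 b.
  by rewrite subr_ge0 -(P1 c0) (bigD1 b)//= lerDl sumr_ge0.
elim: M m k a => [|M IH] [|m] k a /=.
- by rewrite setIT expr0 mul1r.
- by rewrite setI0 {1}/pr measure0 mulr_ge0 ?exprn_ge0 ?pr_ge0.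
- by rewrite setIT expr0 mul1r.
(* Being determined at time [k], the event [E k] holds on the whole cylinder or nowhere on it. *)
have [[w Ekw cw]|nE] := pselect (exists2 w, E k w & cyl k a w).
  have -> : cyl k a `&` (~` E k `&` miss b E M m.+1 k.+1 `|`
      (E k `\` s k.+1 @^-1` [set b]) `&` miss b E M m k.+1) =
      cyl k a `&` (~` (s k.+1 @^-1` [set b]) `&` miss b E M m k.+1).
    apply/seteqP; split => w' [cw'].
      have Ew' : E k w' by apply: (dE k w) => // i ik; rewrite cw// cw'.
      by move=> [[/(_ Ew')]|[[_ ?] ?]].
    have Ew' : E k w' by apply: (dE k w) => // i ik; rewrite cw// cw'.
    by move=> [? ?]; split => //; right.
  rewrite pr_split_cyl; last first.
    by apply: measurableI; [exact: measurableC|exact: measurable_miss].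
  rewrite exprS -mulrA mulrCA.
  (* The next state must differ from [b]; the other states have total mass [1 - P c0 b], since the
     cylinder ends in [c0]. *)
  apply: (@le_trans _ _ (\sum_(c | c != b) (1 - P c0 b) ^+ m *
      pr (cyl k.+1 (upd k.+1 a c)))); last first.
    rewrite -mulr_sumr ler_wpM2l ?exprn_ge0//.
    under eq_bigr do rewrite pr_cylS.
    rewrite -mulr_suml ler_wpM2r// -(Ea _ _ Ekw) cw//.
    by rewrite -(P1 (a k)) [X in _ <= X - _](bigD1 b)//= addrAC subrr add0r.
  rewrite (bigD1 b)//= (_ : pr _ = 0) ?add0r; last first.
    rewrite (_ : _ `&` _ = set0) ?/pr ?measure0//; apply/seteqP; split => // w'.
    by rewrite setIA => -[[/cylS[_ +] +] _]; exact.
  apply: ler_sum => c cb; apply: le_trans (IH m k.+1 _).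
  have mm := measurable_miss b M m k.+1 dE.
  apply: pr_le; [|exact: measurableI|by move=> w' [? []]].
  by do 2!apply: measurableI => //; exact: measurableC.
have -> : cyl k a `&` (~` E k `&` miss b E M m.+1 k.+1 `|`
      (E k `\` s k.+1 @^-1` [set b]) `&` miss b E M m k.+1) =
      cyl k a `&` miss b E M m.+1 k.+1.
  apply/seteqP; split => w' [cw'].
    by move=> [[]//|[[Ew' _] _]]; case: nE; exists w'.
  by move=> h; split => //; left; split => // Ew'; apply: nE; exists w'.
have mm := measurable_miss b M m.+1 k.+1 dE.
rewrite pr_split_cyl// -(setIT (cyl k a)) pr_split_cyl// mulr_sumr.
by apply: ler_sum => c _; rewrite setIT; exact: IH.
Qed.

(** If every occurrence of [E] after time [K] is missed, then for each [m] the first [m] are, an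
    event [U m] of probability at most [(1 - P c0 b)^m]. So the failure set for [K] lies in a null
    set, and there are countably many [K]. *)
Lemma infinitely_often_step (c0 b : 'I_n) E :
  (forall k, determined k (E k)) -> (forall k w, E k w -> s k w = c0) ->
  0 < P c0 b ->
  {ae Pr, forall w, infinitely_often E w ->
    infinitely_often (fun k => E k `&` (s k.+1 @^-1` [set b])) w}.
Proof.
move=> dE Ea P0; have [P0' P1] := P_stochastic.
set q := 1 - P c0 b.
have q0 : 0 <= q.
  by rewrite /q subr_ge0 -(P1 c0) (bigD1 b)//= lerDl sumr_ge0.
have q1 : q < 1 by rewrite /q ltrBlDr ltrDl.
suff H K : {ae Pr, forall w, infinitely_often E w ->
    exists2 k, (K <= k)%N & (E k `&` (s k.+1 @^-1` [set b])) w}.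
  have := ae_foralln H; apply: filterS => w h iE K; exact: h.
pose U m := \bigcup_M miss b E M m K.
have mM m M := measurable_miss b M m K dE.
have mU m : measurable (U m) by exact: bigcup_measurable.
have PU m : pr (U m) <= q ^+ m.
  rewrite -lee_fin prK//.
  have cv := nondecreasing_cvg_mu (mM m) (mU m) (@miss_homo b E m K) (mu := Pr).
  rewrite -(cvg_lim _ cv)//; apply: lime_le; first by apply/cvg_ex; eexists; exact: cv.
  apply: nearW => M /=; rewrite -prK// lee_fin.
  by apply: (@pr_cyl_le K) => // a; exact: pr_miss_le.
exists (\bigcap_m U m); split.
- exact: bigcapT_measurable.
- apply/eqP; rewrite eq_le measure_ge0 andbT.
  rewrite -prK; last exact: bigcapT_measurable.
  rewrite lee_fin; apply/ler_addgt0Pr => e e0; rewrite add0r.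
  have /cvgrPdist_lt h : q ^+ m @[m --> \oo] --> 0.
    by apply: cvg_expr; rewrite ger0_norm.
  have [m _ /(_ m (leqnn m))] := h e e0.
  rewrite /= sub0r normrN ger0_norm ?exprn_ge0// => qm.
  apply: le_trans (ltW qm); apply: le_trans (PU m); apply: pr_le => //.
    exact: bigcapT_measurable.
  by move=> w; exact.
- move=> w /=; rewrite not_implyE => -[iE nE] m _.
  have {}nE k : (K <= k)%N -> E k w -> s k.+1 w != b.
    by move=> Kk Ek; apply: contra_notN nE => /eqP sb; exists k.
  (* Outer induction on the number [m] of occurrences, inner induction on the waiting time [i] for
     the next one; together they produce a finite window. *)
  suff : forall k, (K <= k)%N -> exists M, miss b E M m k w.
    by move=> /(_ K (leqnn _)) [M hM]; exists M.
  elim: m => [|m IH] k Kk; first by exists 0.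
  have [k' kk'] := iE k; rewrite -(subnKC kk').
  move: (k' - k)%N {kk'} => i; elim: i k Kk => [|i IHi] k Kk Ek.
    rewrite addn0 in Ek; have [M hM] := IH k.+1 (leqW Kk).
    by exists M.+1; right; split => //; split => //; exact/eqP/nE.
  have [Ek0|Ek0] := pselect (E k w).
    have [M hM] := IH k.+1 (leqW Kk).
    by exists M.+1; right; split => //; split => //; exact/eqP/nE.
  rewrite addnS -addSn in Ek; have [M hM] := IHi _ (leqW Kk) Ek.
  by exists M.+1; left.
Qed.

(** Induction on [m], splitting off the first transition of a path of positive probability from [c]
    to [j]. *)
Lemma infinitely_often_path (m : nat) (c j : 'I_n) E :
  (forall k, determined k (E k)) -> (forall k w, E k w -> s k w = c) ->
  0 < (P ^+ m) c j ->
  {ae Pr, forall w, infinitely_often E w ->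
    infinitely_often (fun k => E k `&` (s (k + m)%N @^-1` [set j])) w}.
Proof.
have [P0 P1] := P_stochastic.
elim: m c E => [|m IH] c E dE Ec.
  rewrite expr0 mxE; have [<- _|_] := eqVneq c j; last by rewrite ltxx.
  apply: aeW => w iE K; have [k Kk Ek] := iE K.
  by exists k => //; split => //=; rewrite addn0; exact: Ec Ek.
rewrite exprS mxE => cj.
have [b /andP[Pb bj]] : exists b, (0 < P c b) && (0 < (P ^+ m) b j).
  apply/existsP; apply: contraTT cj => /existsPn nb.
  rewrite -leNgt; apply: sumr_le0 => b _; have := nb b.
  have Pm0 : 0 <= (P ^+ m) b j.
    elim: (m) b {nb} => [|m' IHm] b; first by rewrite expr0 mxE ler0n.
    by rewrite exprS mxE sumr_ge0// => b' _; rewrite mulr_ge0.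
  rewrite !lt0r Pm0 P0 !andbT negb_and !negbK => /orP[/eqP ->|/eqP ->].
    by rewrite mul0r.
  by rewrite mulr0.
(* [E] held one step earlier and the chain is now in [b]: again determined by the past and with a
   fixed current state, as the induction requires. *)
pose E' k := [set w | exists2 k', k = k'.+1 & E k' w /\ s k w = b].
have dE' k : determined k (E' k).
  move=> w w' ww' [k' kk' [Ek' sb]]; exists k' => //.
  rewrite -(ww' k (leqnn _)); split => //.
  by apply: (dE _ _ _ _ Ek') => i ik; apply: ww'; rewrite kk' leqW.
have E'b k w : E' k w -> s k w = b by case=> ? _ [].
have := infinitely_often_step dE Ec Pb.
apply: filterS2 (IH b E' dE' E'b bj) => w h' h iE K.
have /h' : infinitely_often E' w.
  move=> K'; have [k Kk [Ek sk]] := h iE K'.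
  by exists k.+1; [exact: leqW|exists k].
move=> /(_ K.+1)[k Kk [[k' kk' [Ek' _]] sk]].
exists k'; first by rewrite kk' in Kk.
by split => //; move: sk; rewrite kk' /= addSnnS.
Qed.

(** With finitely many states, some state [c] is occupied at infinitely many occurrences of [E];
    irreducibility gives a lag [m] from [c] to [j], which depends on the path only through [c]. *)
Lemma infinitely_often_visit (j : 'I_n) E :
  irreducible_chain P -> (forall k, determined k (E k)) ->
  {ae Pr, forall w, infinitely_often E w ->
    exists m, infinitely_often (fun k => E k `&` (s (k + m)%N @^-1` [set j])) w}.
Proof.
move=> irr dE; pose Ec (c : 'I_n) k := E k `&` (s k @^-1` [set c]).
have dEc c k : determined k (Ec c k).
  by move=> w w' ww' [Ek /= <-]; split; [exact: dE Ek|rewrite /= ww'].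
have H c : {ae Pr, forall w, infinitely_often (Ec c) w -> exists m,
    infinitely_often (fun k => Ec c k `&` (s (k + m)%N @^-1` [set j])) w}.
  have [m cj] := irr c j.
  have := @infinitely_often_path m c j (Ec c) (dEc c) _ cj.
  by move=> /(_ (fun k w => @proj2 _ _)); apply: filterS => w h /h; exists m.
have := filter_forall (F := almost_everywhere Pr) (ae_filter_ringOfSetsType Pr) H.
apply: filterS => w {}H iE.
have [c ic] : exists c, infinitely_often (Ec c) w.
  apply: contrapT => /forallNP nE.
  have {}nE c : exists K, forall k, (K <= k)%N -> ~ Ec c k w.
    have /existsNP[K nK] := nE c; exists K => k Kk Ek; apply: nK.
    by exists k.
  have [K hK] := choice nE.
  have [k Kk Ek] := iE (\max_c K c)%N.
  apply: (hK (s k w) k) => //.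
  exact: leq_trans (leq_bigmax (s k w)) Kk.
have [m im] := H c ic; exists m => K.
by have [k Kk [[Ek _] sk]] := im K; exists k.
Qed.

End recurrence.

(** * Descent along a Walkman trajectory *)

Section descent.
Context {R : realType} {n p : nat}.
Variables (r : 'rV[R]_p -> \bar R) (f : 'I_n -> 'rV[R]_p -> R).
Variables (L gamma beta : R).
Variables (s : nat -> 'I_n) (x : nat -> 'rV[R]_p).
Variables (y z g : nat -> 'I_n -> 'rV[R]_p).

Hypothesis hr : forall u, r u != -oo%E.
Hypothesis r_semiconvex : semiconvex gamma r.
Hypothesis r_lsc : lower_semicontinuous r.
Hypothesis f_smooth : forall i, lipschitz_differentiable L (f i).
Hypothesis obj_bounded : bounded_below (objective r f).
Hypotheses (L_ge0 : 0 <= L) (beta_gt0 : 0 < beta) (gamma_lt : gamma < beta).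
Hypotheses (L_le : 2 * L <= beta) (L_lt : L ^+ 2 / beta < (beta - L) / 2).

Let v k := n%:R^-1 *: \sum_(i < n) (y k i - beta^-1 *: z k i).

Hypothesis x_step : forall k, prox beta^-1 r (v k) (x k.+1).
Hypothesis z_step : forall k,
  z k.+1 (s k) = z k (s k) + beta *: (x k.+1 - y k.+1 (s k)).
(* [g k i] is the point at which agent [i] last evaluated its gradient: the
   current [y k i] in the proximal variant, the previous one in the gradient
   variant. *)
Hypothesis z_grad : forall k, z k.+1 (s k) = grad (f (s k)) (g k.+1 (s k)).
Hypothesis g_step : forall k,
  (g k (s k) = y k (s k) /\ g k.+1 (s k) = y k.+1 (s k)) \/
  g k.+1 (s k) = y k (s k).
Hypothesis idle : forall k i, i != s k ->
  [/\ y k.+1 i = y k i, z k.+1 i = z k i & g k.+1 i = g k i].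

(** Holds for an agent from its first activation on; before that the initial dual variable is
    arbitrary. *)
Let fresh k := forall i, z k i = grad (f i) (g k i).

(** The augmented Lagrangian of agent [i], plus a memory term that pays for gradients evaluated at
    an earlier point. *)
Let block k i u : R :=
  f i (y k i) + dotp (z k i) (u - y k i) + beta / 2 * enorm (u - y k i) ^+ 2
  + L ^+ 2 / beta * enorm (y k i - g k i) ^+ 2.

Let lyap k := fine (r (x k)) + n%:R^-1 * \sum_(i < n) block k i (x k).

Let c := (beta - L) / 2 - L ^+ 2 / beta.

Let c_gt0 : 0 < c. Proof. by rewrite subr_gt0. Qed.

Let n_gt0 : 0 < (n%:R : R).
Proof. by rewrite ltr0n; case: n (s 0%N) => [[]|]. Qed.

Let enorm_le_sqr (a : R) (u w : 'rV[R]_p) : 0 <= a -> enorm u <= a * enorm w ->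
  enorm u ^+ 2 <= a ^+ 2 * enorm w ^+ 2.
Proof.
move=> a0 h; rewrite -exprMn ler_pXn2r// nnegrE ?mulr_ge0 ?enorm_ge0//.
Qed.

Let block_descent k : fresh k ->
  block k.+1 (s k) (x k.+1) <=
  block k (s k) (x k.+1) - c * enorm (y k.+1 (s k) - y k (s k)) ^+ 2.
Proof.
move=> /(_ (s k)); have := z_grad k; have := z_step k; have := g_step k.
rewrite /block; have := f_smooth (s k).
set i := s k; set X := x k.+1; set y' := y k.+1 i; set z' := z k.+1 i.
set g' := g k.+1 i; set y_ := y k i; set z_ := z k i; set g_ := g k i.
move=> lf hg hz hz' hz_.
have b1 : beta * beta^-1 = 1 by rewrite divff ?gt_eqF.
(* [z'] is the gradient at [y'] in the first case, where the lower bound for [f i y_] is used, and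
   at [y_] in the second, where the upper bound for [f i y'] is. *)
have F : f i y' <= f i y_ + dotp z' (y' - y_) + L / 2 * enorm (y' - y_) ^+ 2.
  case: hg => [[_ gE]|gE].
    have := grad_lower y_ y' lf; rewrite hz' gE -(opprB y') dotpNr enormN; lra.
  by rewrite hz' gE; exact: grad_upper.
(* The cost of the dual ascent: [beta (X - y')] is the dual increment, a difference of gradients
   because the state is fresh. *)
have D : beta * enorm (X - y') ^+ 2 <= L ^+ 2 / beta * enorm (g' - g_) ^+ 2.
  have -> : beta * enorm (X - y') ^+ 2 = beta^-1 * enorm (z' - z_) ^+ 2.
    rewrite hz addrAC subrr add0r enormZ exprMn real_normK ?num_real//.
    by rewrite expr2 !mulrA mulVf ?gt_eqF// mul1r.
  rewrite [L ^+ 2 / _]mulrC -mulrA ler_pM2l ?invr_gt0//.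
  by apply: enorm_le_sqr => //; rewrite hz' hz_; case: lf => _; exact.
have E1 : dotp z' (X - y') = dotp z_ (X - y') + beta * enorm (X - y') ^+ 2.
  by rewrite {1}hz dotpDl dotpZl -enorm_sqr.
have E2 : dotp z' (y' - y_) = dotp z_ (y' - y_) + beta * dotp (X - y') (y' - y_).
  by rewrite {1}hz dotpDl dotpZl.
have E3 : dotp z_ (X - y_) = dotp z_ (X - y') + dotp z_ (y' - y_).
  by rewrite -dotpDr addrA subrK.
have E4 : enorm (X - y_) ^+ 2 = enorm (X - y') ^+ 2 + enorm (y' - y_) ^+ 2
    + 2 * dotp (X - y') (y' - y_).
  by rewrite (enorm_sqr_shift X y_ y') dotpC.
rewrite /c E1 E3 E4; rewrite E2 in F.
(* In the first case both memory terms vanish and the dual cost is at most [L^2 / beta |y' - y_|^2].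
   In the second the old memory term pays the dual cost and the new one is
   [L^2 / beta |y' - y_|^2]. *)
case: hg => [[gE gE']|gE].
  move: D; rewrite gE gE' !subrr enorm0 expr0n mulr0.
  lra.
move: D; rewrite gE; lra.
Qed.

(** The descent lemma at [y k i], with [z k i] in place of the gradient there. Young's inequality
    splits the mismatch between the memory term and half of the penalty; [2 L <= beta] leaves the
    other half for the curvature of [f i]. *)
Let block_lower k i u : fresh k -> f i u <= block k i u.
Proof.
move=> /(_ i) hz; rewrite /block; have := grad_upper u (y k i) (f_smooth i).
have := dotp_le (grad (f i) (y k i) - z k i) (u - y k i); rewrite dotpBl.
have := proj2 (f_smooth i) (y k i) (g k i); rewrite -hz.
set G := enorm (_ - z k i); set D := enorm (y k i - _); set U := enorm (u - _).
move=> h1 h2 h3.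
have h4 : G * U <= L * D * U by rewrite ler_wpM2r// enorm_ge0.
have h5 : L * D * U <= L ^+ 2 / beta * D ^+ 2 + beta / 4 * U ^+ 2.
  rewrite -subr_ge0.
  have -> : L ^+ 2 / beta * D ^+ 2 + beta / 4 * U ^+ 2 - L * D * U =
      beta^-1 * (L * D - beta / 2 * U) ^+ 2 by field; rewrite gt_eqF.
  by rewrite mulr_ge0 ?sqr_ge0// invr_ge0 ltW.
have h6 : L / 2 * U ^+ 2 <= beta / 4 * U ^+ 2.
  by rewrite ler_wpM2r ?sqr_ge0//; have := L_le; lra.
lra.
Qed.

(** All blocks are quadratic in [u] with the same Hessian, so their mean is a constant plus
    [beta / 2 |u - v k|^2]: the proximal step minimizes [r] plus the mean of the blocks. *)
Let mean_diff k u w :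
  n%:R^-1 * \sum_(i < n) block k i u - n%:R^-1 * \sum_(i < n) block k i w =
  beta / 2 * enorm (u - v k) ^+ 2 - beta / 2 * enorm (w - v k) ^+ 2.
Proof.
rewrite -mulrBr -sumrB.
have E i : block k i u - block k i w = beta / 2 *
    (dotp (u - w) (u + w) - 2 * dotp (u - w) (y k i - beta^-1 *: z k i)).
  rewrite /block !enorm_sqr !dotpE.
  rewrite !(dotpC (y k i)) !(dotpC (z k i)) (dotpC w u).
  by field; rewrite gt_eqF.
under eq_bigr do rewrite E.
rewrite -mulr_sumr sumrB -mulr_sumr sumr_const card_ord -dotp_sumr.
have -> : \sum_(i < n) (y k i - beta^-1 *: z k i) = n%:R *: v k.
  by rewrite /v scalerA divff ?gt_eqF// scale1r.
rewrite -mulr_natl; move: (v k) => V; rewrite !enorm_sqr !dotpE !(dotpC V) (dotpC w u).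
by field; rewrite gt_eqF.
Qed.

Let x_fin k : r (x k.+1) \is a fin_num.
Proof. exact: (prox_fin_num hr (x_step k)). Qed.

(** The step in [x] gains by [prox_strong], the active block by [block_descent], and the other
    blocks do not change. [k] is positive because [x 0] is free and [r] may be infinite there. *)
Let lyap_descent k : (0 < k)%N -> fresh k ->
  (beta - gamma) / 2 * enorm (x k.+1 - x k) ^+ 2 +
  n%:R^-1 * c * enorm (y k.+1 (s k) - y k (s k)) ^+ 2 <= lyap k - lyap k.+1.
Proof.
case: k => // k _ fk; set K := k.+1.
have := prox_strong hr beta_gt0 r_semiconvex (x_step K) (x_fin k).
have := mean_diff K (x K) (x K.+1); rewrite -/K (enorm_distC (x K) (x K.+1)).
have : n%:R^-1 * \sum_(i < n) block K.+1 i (x K.+1) <=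
    n%:R^-1 * \sum_(i < n) block K i (x K.+1)
    - n%:R^-1 * (c * enorm (y K.+1 (s K) - y K (s K)) ^+ 2).
  rewrite -mulrBr ler_pM2l ?invr_gt0//.
  rewrite (bigD1 (s K))//= [X in _ <= X - _](bigD1 (s K))//= [X in _ <= X]addrAC lerD//.
    exact: block_descent.
  by apply: ler_sum => i /idle[ey ez eg]; rewrite /block ey ez eg.
rewrite /lyap; lra.
Qed.

Let lyap_lower m : (forall u, (m%:E <= objective r f u)%E) ->
  forall k, (0 < k)%N -> fresh k -> m <= lyap k.
Proof.
move=> hm [|k] // _ fk; rewrite -lee_fin (le_trans (hm (x k.+1)))//.
rewrite /objective -[r _]fineK// -EFinD lee_fin lerD2l ler_pM2l ?invr_gt0//.
by apply: ler_sum => i _; exact: block_lower.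
Qed.

(** * Vanishing increments, consensus and the limit inequality *)

Hypothesis visits : forall i K, exists2 k, (K <= k)%N & s k = i.

Let eventually_fresh : exists K, forall k, (K <= k)%N -> (0 < k)%N /\ fresh k.
Proof.
have H i : exists K, forall k, (K <= k)%N -> z k i = grad (f i) (g k i).
  have [K _ sK] := visits i 0; exists K.+1; elim=> // k IH.
  rewrite ltnS leq_eqVlt => /predU1P[<-|/IH zk]; first by rewrite -sK.
  by have [->|/idle[_ -> ->]] := eqVneq i (s k).
have [K hK] := choice H; exists (\max_i K i).+1 => k Kk; split.
  exact: leq_trans Kk.
move=> i; apply: hK; apply: leq_trans (ltnW Kk).
exact: leq_bigmax.
Qed.

Lemma x_increment_vanishing : vanishing (fun k => x k.+1 - x k).
Proof.
have [K hK] := eventually_fresh; have [m hm] := obj_bounded.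
apply: (@vanishing_descent _ _ lyap _ m ((beta - gamma) / 2) K).
- by have := gamma_lt; lra.
- by move=> k /hK[k0 fk]; exact: lyap_lower.
- move=> k /hK[k0 fk]; apply: le_trans (lyap_descent k0 fk).
  by rewrite lerDl mulr_ge0 ?sqr_ge0// mulr_ge0 ?invr_ge0 ?ler0n ?(ltW c_gt0).
Qed.

Lemma y_increment_vanishing i : vanishing (fun k => y k.+1 i - y k i).
Proof.
have [K hK] := eventually_fresh; have [m hm] := obj_bounded.
apply: (@vanishing_descent _ _ lyap _ m (n%:R^-1 * c) K).
- by rewrite mulr_gt0// invr_gt0.
- by move=> k /hK[k0 fk]; exact: lyap_lower.
- move=> k /hK[k0 fk]; apply: le_trans (lyap_descent k0 fk).
  have h : 0 <= (beta - gamma) / 2 * enorm (x k.+1 - x k) ^+ 2.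
    by rewrite mulr_ge0 ?sqr_ge0//; have := gamma_lt; lra.
  have [->|/idle[-> _ _]] := eqVneq i (s k); first by rewrite lerDr.
  rewrite subrr enorm0 expr0n mulr0 addr_ge0//.
  by rewrite mulr_ge0 ?sqr_ge0// mulr_ge0 ?invr_ge0 ?ler0n ?(ltW c_gt0).
Qed.

(** The gap is constant while [i] is idle, and after an activation it is 0 or the last increment of
    [y]; the induction starts from a late visit to [i]. *)
Lemma memory_vanishing i : vanishing (fun k => y k i - g k i).
Proof.
move=> e e0; have [K hK] := (@y_increment_vanishing i) _ e0.
have [t Kt st] := visits i K; exists t.+1; elim=> // k IH tk.
have Kk : (K <= k)%N by apply: leq_trans Kt _.
have [ik|ik] := eqVneq i (s k); last first.
  have [-> _ ->] := idle ik; apply: IH.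
  rewrite ltn_neqAle -ltnS tk andbT; apply: contraNneq ik => <-.
  by rewrite st.
have := hK k Kk; have := g_step k; rewrite -ik => -[[_ ->]|-> //].
by rewrite subrr enorm0.
Qed.

Lemma z_increment_vanishing i : vanishing (fun k => z k.+1 i - z k i).
Proof.
have [K hK] := eventually_fresh.
have dg : vanishing (fun k => g k.+1 i - g k i).
  move=> e e0; have m0 := @memory_vanishing i.
  have h := vanishingB (@y_increment_vanishing i)
    (vanishingB (vanishing_shift 1 m0) m0).
  have [K' hK'] := h e e0; exists K' => k /hK'; rewrite addn1.
  congr (enorm _ < _).
  by apply/rowP => j; rewrite !mxE; ring.
apply: (vanishing_le (C := L) (K := K) dg) => k Kk.
have [_ fk] := hK k Kk; have [_ fk1] := hK k.+1 (leqW Kk).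
by rewrite fk fk1; case: (f_smooth i) => _; exact.
Qed.

(** The levels [1 / (t + 1)] keep the events countable. The iterates carry the index [k.+1] because
    those are determined by the states up to time [k]. *)
Hypothesis recur : forall i (t : nat), let e := t.+1%:R^-1 in
  (forall K, exists2 k, (K <= k)%N & e <= enorm (x k.+1 - y k.+1 i)) ->
  exists m, forall K, exists2 k, (K <= k)%N &
    e <= enorm (x k.+1 - y k.+1 i) /\ s (k + m)%N = i.

Lemma consensus_vanishing i : vanishing (fun k => x k - y k i).
Proof.
pose w k := x k - y k i.
suff H (t : nat) : exists K, forall k, (K <= k)%N -> enorm (w k) < t.+1%:R^-1.
  move=> e /ltr_add_invr[t]; rewrite add0r => te.
  by have [K hK] := H t; exists K => k /hK wk; exact: lt_trans te.
have e0 : 0 < (t.+1%:R : R)^-1 by rewrite invr_gt0 ltr0n.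
set e := _^-1 in e0 *.
have [] := pselect (forall K, exists2 k, (K <= k)%N & e <= enorm (w k.+1)).
  move=> /recur /= [m]; rewrite -/e => hm; exfalso.
  have dw : vanishing (fun k => w k.+1 - w k).
    move=> e' e'0.
    have [K hK] := vanishingB x_increment_vanishing
      (@y_increment_vanishing i) e'0.
    exists K => k /hK; congr (enorm _ < _).
    by rewrite /w; apply/rowP => j; rewrite !mxE; ring.
  have e2 : 0 < e / 2 by lra.
  have [K hK] := vanishing_increment m dw e2.
  have [K' hK'] := vanishingZ beta^-1 (@z_increment_vanishing i) e2.
  have [k] := hm (maxn K K'); rewrite geq_max => /andP[Kk Kk'] [ek sk].
  have h1 := hK k.+1 (leqW Kk).
  have h2 := hK' (k + m)%N (leq_trans Kk' (leq_addr _ _)).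
  (* Just after an activation of [i] the gap is a multiple of the dual increment, hence below
     [e / 2]; over the [m] steps in between it moves by less than [e / 2]. *)
  have E : w (k + m).+1 = beta^-1 *: (z (k + m).+1 i - z (k + m)%N i).
    rewrite -sk z_step addrAC subrr add0r scalerA mulVf ?gt_eqF// scale1r.
    by rewrite /w sk.
  move: ek; apply/negP; rewrite -ltNge -/(w k.+1).
  rewrite -(subKr (w (k + m).+1) (w k.+1)); apply: le_lt_trans (enormB _ _) _.
  by rewrite addSn in h1; rewrite -E in h2; lra.
move=> /existsNP[K hK]; exists K.+1 => -[//|k] Kk.
by rewrite ltNge; apply/negP => ek; apply: hK; exists k.
Qed.

Lemma gradient_vanishing i : vanishing (fun k => z k i - grad (f i) (x k)).
Proof.
have [K hK] := eventually_fresh.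
have gx : vanishing (fun k => (x k - y k i) + (y k i - g k i)).
  exact: vanishingD (@consensus_vanishing i) (@memory_vanishing i).
apply: (vanishing_le (C := L) (K := K) gx) => k /hK[_ ->].
by rewrite addrA subrK (enorm_distC (x k)); case: (f_smooth i) => _; exact.
Qed.

Lemma limit_semi_subgradient xs :
  (forall (e : R) K, 0 < e -> exists2 k, (K <= k)%N & enorm (x k - xs) < e) ->
  semi_subgradient gamma r xs (- (n%:R^-1 *: \sum_(i < n) grad (f i) xs)).
Proof.
move=> hxs; apply: (semi_subgradient_closed hr r_lsc) => e e0.
(* The residual of stationarity along the path. Its opposite is the mean of
   [beta (x - y_i) + (z_i - grad f_i x)] plus [beta] times the increment of [x]. *)
pose q k := beta *: (v k - x k.+1) + n%:R^-1 *: \sum_(i < n) grad (f i) (x k).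
have q0 : vanishing q.
  move=> e' e'0.
  have h i := vanishingD (vanishingZ beta (@consensus_vanishing i))
    (@gradient_vanishing i).
  have [K hK] := vanishingD (vanishingZ (n%:R^-1) (vanishing_sum h))
    (vanishingZ beta x_increment_vanishing) e'0.
  exists K => k /hK; rewrite -(enormN (q k)); congr (enorm _ < _).
  have -> : \sum_(i < n) (beta *: (x k - y k i) + (z k i - grad (f i) (x k))) =
      (n%:R * beta) *: x k - beta *: \sum_(i < n) (y k i - beta^-1 *: z k i)
      - \sum_(i < n) grad (f i) (x k).
    have -> : (n%:R * beta) *: x k = \sum_(i < n) beta *: x k.
      by rewrite sumr_const card_ord -scalerA scaler_nat.
    rewrite scaler_sumr -!sumrB; apply: eq_bigr => i _.
    by apply/rowP => j; rewrite !mxE; field; rewrite gt_eqF.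
  rewrite /q /v; move: (\sum_i _) (\sum_i grad _ _) => S T.
  by apply/rowP => j; rewrite !mxE; field; rewrite gt_eqF.
have e2 : 0 < e / 2 by lra.
have [K hK] := q0 _ e2; have [K' hK'] := x_increment_vanishing e2.
have d0 : 0 < e / 2 / (L + 1) by rewrite divr_gt0// ltr_wpDl.
have [|k] := hxs (Num.min (e / 2) (e / 2 / (L + 1))) (maxn K K').
  by rewrite lt_min e2.
rewrite geq_max => /andP[Kk Kk']; rewrite lt_min => /andP[x1 x2].
exists (x k.+1), (beta *: (v k - x k.+1)); split.
- have -> : x k.+1 - xs = (x k.+1 - x k) + (x k - xs) by rewrite addrA subrK.
  by apply: le_lt_trans (enormD _ _) _; have := hK' k Kk'; lra.
- have -> : beta *: (v k - x k.+1) - - (n%:R^-1 *: \sum_(i < n) grad (f i) xs)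
      = q k - n%:R^-1 *: \sum_(i < n) (grad (f i) (x k) - grad (f i) xs).
    rewrite /q sumrB; move: (\sum_i grad _ (x k)) (\sum_i grad _ xs) => S T.
    by apply/rowP => j; rewrite !mxE; ring.
  apply: le_lt_trans (enormB _ _) _; have h1 := hK k Kk.
  suff : enorm (n%:R^-1 *: \sum_(i < n) (grad (f i) (x k) - grad (f i) xs))
      <= L * enorm (x k - xs).
    by move: x2; rewrite ltr_pdivlMr ?ltr_wpDl//; have := enorm_ge0 (x k - xs); nra.
  rewrite enormZ gtr0_norm ?invr_gt0// ler_pdivrMl//.
  apply: le_trans (enorm_sum _) _.
  rewrite -[n in n%:R](card_ord n) mulr_natl -sumr_const.
  by apply: ler_sum => i _; case: (f_smooth i) => _; exact.
- exact: prox_semi_subgradient.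
Qed.

End descent.

(** * Walkman trajectories as instances of the descent scheme *)

Section walkman_trace.
Context {R : realType} {n p : nat}.
Variables (r : 'rV[R]_p -> \bar R) (f : 'I_n -> 'rV[R]_p -> R).
Variables (L gamma beta : R) (y0 z0 : 'M[R]_(n, p)).
Hypothesis beta_gt0 : 0 < beta.

(** Each update replaces exactly the summand of the active agent, so [xbar] remains the mean it is
    initialized to. *)
Lemma walkman_xbar_mean upd s x xbar (y z : nat -> 'M[R]_(n, p)) :
  walkman r beta upd y0 z0 s x xbar y z -> forall k,
  xbar k.+1 = n%:R^-1 *: \sum_(i < n) (row i (y k) - beta^-1 *: row i (z k)).
Proof.
move=> W; elim=> [|k IH].
  by rewrite (walkman_xbar1 W) (walkman_y0 W) (walkman_z0 W).
rewrite (walkman_xbar W) IH [in RHS](bigD1 (s k))//= (bigD1 (s k))//=.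
rewrite [in RHS](eq_bigr (fun i => row i (y k) - beta^-1 *: row i (z k))); last first.
  by move=> i ik; rewrite (walkman_y_idle W ik) (walkman_z_idle W ik).
move: (\sum_(i < n | _) _) => S.
by apply/rowP => j; rewrite !mxE; ring.
Qed.

(** With single-valued updates the iterates are functions of the past walk; this makes events about
    them [determined]. *)
Lemma walkman_unique upd s s' x x' xbar xbar' (y y' z z' : nat -> 'M[R]_(n, p)) :
  (forall v u u', prox beta^-1 r v u -> prox beta^-1 r v u' -> u = u') ->
  (forall i v yi zi u u', upd i v yi zi u -> upd i v yi zi u' -> u = u') ->
  walkman r beta upd y0 z0 s x xbar y z ->
  walkman r beta upd y0 z0 s' x' xbar' y' z' ->
  forall k, (forall m, (m <= k)%N -> s m = s' m) ->
  x k.+1 = x' k.+1 /\ y k.+1 = y' k.+1.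
Proof.
move=> prox_u upd_u W W'.
have step k : s k = s' k -> y k = y' k -> z k = z' k ->
    [/\ x k.+1 = x' k.+1, y k.+1 = y' k.+1 & z k.+1 = z' k.+1].
  move=> es ey ez.
  have ex : x k.+1 = x' k.+1.
    apply: prox_u (walkman_x W k) _; rewrite (walkman_xbar_mean W) ey ez.
    by rewrite -(walkman_xbar_mean W'); exact: walkman_x W' k.
  have eyk : row (s k) (y k.+1) = row (s k) (y' k.+1).
    apply: upd_u (walkman_y W k) _.
    by rewrite ex ey ez es; exact: walkman_y W' k.
  have ey' : y k.+1 = y' k.+1.
    apply/row_matrixP => i; have [->//|ik] := eqVneq i (s k).
    by rewrite (walkman_y_idle W ik) ey (walkman_y_idle W') -?es.
  split=> //; apply/row_matrixP => i; have [->|ik] := eqVneq i (s k).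
    rewrite (walkman_z W) ex ey' ez es; exact/esym/(walkman_z W').
  by rewrite (walkman_z_idle W ik) ez (walkman_z_idle W') -?es.
move=> k ss'; suff [ey ez] : y k = y' k /\ z k = z' k.
  by have [] := step k (ss' k (leqnn k)) ey ez.
elim: k ss' => [|k IH] ss'.
  by rewrite (walkman_y0 W) (walkman_y0 W') (walkman_z0 W) (walkman_z0 W').
have [ey ez] : y k = y' k /\ z k = z' k by apply: IH => m mk; apply/ss'/leqW.
by have [] := step k (ss' k (leqnSn k)) ey ez.
Qed.

Hypotheses (L_ge0 : 0 <= L) (f_smooth : forall i, lipschitz_differentiable L (f i)).

(** The gradients at the two points differ by [beta (u' - u)], which the Lipschitz bound with
    [L < beta] allows only if [u = u']. *)
Lemma prox_update_unique i v yi zi u u' : L < beta ->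
  prox_update f beta i v yi zi u -> prox_update f beta i v yi zi u' -> u = u'.
Proof.
move=> Lb /(prox_smooth L_ge0 beta_gt0 (f_smooth i)) h.
move=> /(prox_smooth L_ge0 beta_gt0 (f_smooth i)) h'.
have := proj2 (f_smooth i) u u'; rewrite h h' -scalerBr.
rewrite (_ : _ - u - (_ - u') = u' - u); last by apply/rowP => j; rewrite !mxE; ring.
rewrite enormZ gtr0_norm// enorm_distC => le_L.
apply/eqP; rewrite -subr_eq0 -enorm_eq0 eq_le enorm_ge0 andbT leNgt.
apply/negP => u0; move: le_L; apply/negP; rewrite -ltNge ltr_pM2r//.
Qed.

Lemma prox_walkman_memory s x xbar y z :
  walkman r beta (prox_update f beta) y0 z0 s x xbar y z ->
  exists g : nat -> 'I_n -> 'rV[R]_p, [/\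
    forall k, row (s k) (z k.+1) = grad (f (s k)) (g k.+1 (s k)),
    forall k, (g k (s k) = row (s k) (y k) /\ g k.+1 (s k) = row (s k) (y k.+1))
      \/ g k.+1 (s k) = row (s k) (y k)
    & forall k i, i != s k -> g k.+1 i = g k i].
Proof.
move=> W; exists (fun k i => row i (y k)); split; last exact: walkman_y_idle W.
- move=> k; rewrite (prox_smooth L_ge0 beta_gt0 (f_smooth _) (walkman_y W k)).
  by rewrite (walkman_z W); apply/rowP => j; rewrite !mxE; field; rewrite gt_eqF.
- by move=> k; left.
Qed.

Lemma grad_walkman_memory s x xbar y z :
  walkman r beta (grad_update f beta) y0 z0 s x xbar y z ->
  exists g : nat -> 'I_n -> 'rV[R]_p, [/\
    forall k, row (s k) (z k.+1) = grad (f (s k)) (g k.+1 (s k)),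
    forall k, (g k (s k) = row (s k) (y k) /\ g k.+1 (s k) = row (s k) (y k.+1))
      \/ g k.+1 (s k) = row (s k) (y k)
    & forall k i, i != s k -> g k.+1 i = g k i].
Proof.
move=> W.
(* The initial value 0 is a placeholder: the first activation of an agent overwrites it, and
   freshness is claimed only afterwards. *)
pose g := fix g k i := if k is k'.+1 then
  if i == s k' then row i (y k') else g k' i else 0 : 'rV[R]_p.
exists g; split=> /= k.
- rewrite eqxx (walkman_z W) (walkman_y W k).
  by apply/rowP => j; rewrite !mxE; field; rewrite gt_eqF.
- by right; rewrite eqxx.
- by move=> i /negbTE ->.
Qed.

End walkman_trace.

Section parameters.
Context {R : realType} {n p : nat}.

(* [L < 0] is possible only in dimension [p = 0], where [0] is also a Lipschitz
   constant. *)
Lemma walkman_parameters (f : 'I_n -> 'rV[R]_p -> R) (L beta : R) : 0 < beta ->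
  (forall i, lipschitz_differentiable L (f i)) ->
  2 * L + 2 < beta \/ 2 * L ^+ 2 + L + 2 < beta ->
  exists L' : R, [/\ 0 <= L', forall i, lipschitz_differentiable L' (f i),
    2 * L' <= beta & L' ^+ 2 / beta < (beta - L') / 2].
Proof.
move=> b0 lf hb; have [L0|L0] := leP 0 L.
  exists L; split => //; first by case: hb; nra.
  (* In the first case [beta (beta - L) / 2] exceeds [(L + 1) (L + 2)]; in the second
     [(beta - L) / 2 > L^2 + 1] and [beta > 2]. *)
  by rewrite ltr_pdivrMr//; case: hb => hb; nra.
exists 0; split => //; last 2 first.
- by rewrite mulr0 ltW.
- by rewrite expr0n mul0r subr0 divr_gt0.
move=> i; case: (lf i) => df h; split => // u v; rewrite mul0r.
by apply: le_trans (h u v) _; rewrite nmulr_rle0// enorm_ge0.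
Qed.

End parameters.

Lemma cluster_frequently {T : topologicalType} (u : nat -> T) (a : T) (B : set T) :
  cluster (u k @[k --> \oo]) a -> nbhs a B ->
  forall K, exists2 k, (K <= k)%N & B (u k).
Proof.
move=> ua aB K.
have [|_ [[k Kk <-] Bk]] := ua (u @` [set k | (K <= k)%N]) B _ aB.
  by exists K => // k Kk; exists k.
by exists k.
Qed.


(** * Limit points of a single trajectory *)

Section walkman_limit.
Context {R : realType} {n p : nat}.
Variables (r : 'rV[R]_p -> \bar R) (f : 'I_n -> 'rV[R]_p -> R).
Variables (L gamma beta : R) (y0 z0 : 'M[R]_(n, p)).
Variables (s : nat -> 'I_n) (x xbar : nat -> 'rV[R]_p).
Variables (y z : nat -> 'M[R]_(n, p)).

(** Deterministic part of the argument: one path, on which the visits and the recurrence of large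
    gaps are assumed. *)
Lemma walkman_cluster (upd : update_rule) xs (ys zs : 'M[R]_(n, p)) :
  (forall u, r u != -oo%E) -> semiconvex gamma r -> lower_semicontinuous r ->
  (forall i, lipschitz_differentiable L (f i)) ->
  bounded_below (objective r f) ->
  0 <= L -> 0 < beta -> gamma < beta -> 2 * L <= beta ->
  L ^+ 2 / beta < (beta - L) / 2 ->
  upd = prox_update f beta \/ upd = grad_update f beta ->
  walkman r beta upd y0 z0 s x xbar y z ->
  (forall i K, exists2 k, (K <= k)%N & s k = i) ->
  (forall i (t : nat), let e := t.+1%:R^-1 in
    (forall K, exists2 k, (K <= k)%N & e <= enorm (x k.+1 - row i (y k.+1))) ->
    exists m, forall K, exists2 k, (K <= k)%N &
      e <= enorm (x k.+1 - row i (y k.+1)) /\ s (k + m)%N = i) ->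
  cluster ((x k, y k, z k) @[k --> \oo]) (xs, ys, zs) ->
  (forall i, xs = row i ys) /\
  semi_subgradient gamma r xs (- (n%:R^-1 *: \sum_(i < n) grad (f i) xs)).
Proof.
move=> hr sc lsc lf bd L0 b0 gb Lb Lb' updE W visits recur cl.
have [g [zg gs gi]] : exists g : nat -> 'I_n -> 'rV[R]_p, [/\
    forall k, row (s k) (z k.+1) = grad (f (s k)) (g k.+1 (s k)),
    forall k, (g k (s k) = row (s k) (y k) /\ g k.+1 (s k) = row (s k) (y k.+1))
      \/ g k.+1 (s k) = row (s k) (y k)
    & forall k i, i != s k -> g k.+1 i = g k i].
  case: updE => updE; rewrite updE in W.
    exact: (prox_walkman_memory b0 L0 lf W).
  exact: (grad_walkman_memory b0 W).
have idle k i : i != s k ->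
    [/\ row i (y k.+1) = row i (y k), row i (z k.+1) = row i (z k)
      & g k.+1 i = g k i].
  by move=> ik; rewrite (walkman_y_idle W ik) (walkman_z_idle W ik) gi.
have xstep k : prox beta^-1 r
    (n%:R^-1 *: \sum_(i < n) (row i (y k) - beta^-1 *: row i (z k))) (x k.+1).
  by rewrite -(walkman_xbar_mean W); exact: walkman_x W k.
have fst_near (e : R) : 0 < e ->
    nbhs (xs, ys, zs)
      [set t : 'rV[R]_p * 'M[R]_(n, p) * 'M[R]_(n, p) | enorm (t.1.1 - xs) < e].
  move=> e0.
  have c : (t.1.1 @[t --> (xs, ys, zs)] --> xs).
    by apply: (@cvg_comp _ _ _ fst fst); exact: cvg_fst.
  exact: c (near_enorm_lt xs e0).
split; last first.
  apply: (@limit_semi_subgradient R n p r f L gamma beta s x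
    (fun k i => row i (y k)) (fun k i => row i (z k)) g) => //.
  - exact: walkman_z W.
  - by move=> e K e0; exact: (cluster_frequently cl (fst_near e e0) K).
move=> i; have cv := @consensus_vanishing R n p r f L gamma beta s x
  (fun k i => row i (y k)) (fun k i => row i (z k)) g hr sc lf bd L0 b0 gb
  Lb Lb' xstep (walkman_z W) zg gs idle visits recur i.
apply/rowP => j; apply/eqP; rewrite -subr_eq0 -normr_le0 leNgt; apply/negP.
set e := `|_| => e0.
have e3 : 0 < e / 3 by lra.
have [K hK] := cv _ e3.
have snd_near : nbhs (xs, ys, zs) [set t : 'rV[R]_p * 'M[R]_(n, p) * 'M[R]_(n, p) |
    `|ys i j - t.1.2 i j| < e / 3].
  have c : (t.1.2 @[t --> (xs, ys, zs)] --> ys).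
    by apply: (@cvg_comp _ _ _ fst snd); [exact: cvg_fst|exact: cvg_snd].
  have : (fun M : 'M[R]_(n, p) => M i j) M @[M --> ys] --> ys i j.
    exact: coord_continuous.
  by move=> /cvgrPdist_lt /(_ _ e3); exact: c.
have [k Kk [/= h1 h2]] := cluster_frequently cl
  (filterI (fst_near _ e3) snd_near) K.
have := hK k Kk.
have h3 := normr_coord_le (x k - xs) j.
have h4 := normr_coord_le (x k - row i (y k)) j.
rewrite !mxE in h3 h4.
have : e <= `|x k 0 j - xs 0 j| + `|x k 0 j - y k i j| + `|ys i j - y k i j|.
  rewrite /e !mxE (distrC (x k 0 j) (xs 0 j)) (distrC (ys i j)).
  apply: le_trans (lerD (ler_distD (x k 0 j) _ _) (lexx _)).
  exact: ler_distD.
lra.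
Qed.

End walkman_limit.


(** * The almost sure statement for both variants *)

Unset Implicit Arguments.
Set Strict Implicit.
Set Printing Implicit Defensive.

Theorem theorem1 (R : realType) (n p : nat)
  (d : measure_display) (Omega : measurableType d) (Pr : probability Omega R)
  (f : 'I_n -> 'rV[R]_p -> R) (r : 'rV[R]_p -> \bar R)
  (hr : forall x, r x != -oo%E)
  (* (A1) *)
  (P : 'M[R]_n) (q : 'rV[R]_n) (i_ : nat -> Omega -> 'I_n)
  (hP : stochastic P) (hirr : irreducible_chain P) (haper : aperiodic_chain P)
  (hq : stationary_distribution P q) (hi : markov_chain Pr P i_)
  (* (A2) *)
  (hbounded : bounded_below (objective r f)) (hcoercive : coercive (objective r f))
  (* (A3) *)
  (L : R) (hf : forall i, lipschitz_differentiable L (f i))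
  (* (A4) *)
  (gamma : R) (hlsc : lower_semicontinuous r) (hsc : semiconvex gamma r)
  (* Walkman *)
  (beta : R) (hbeta : 0 < beta) (y0 z0 : 'M[R]_(n, p))
  (hinit : n%:R^-1 *: \sum_(i < n) (row i y0 - beta^-1 *: row i z0) = 0)
  (x xbar : nat -> Omega -> 'rV[R]_p) (y z : nat -> Omega -> 'M[R]_(n, p))
  (hwalk :
     (Num.max gamma (2 * L + 2) < beta /\
      forall w, walkman r beta (prox_update f beta) y0 z0 (i_ ^~ w)
                  (x ^~ w) (xbar ^~ w) (y ^~ w) (z ^~ w)) \/
     (Num.max gamma (2 * L ^+ 2 + L + 2) < beta /\
      forall w, walkman r beta (grad_update f beta) y0 z0 (i_ ^~ w)
                  (x ^~ w) (xbar ^~ w) (y ^~ w) (z ^~ w))) :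
  {ae Pr, forall w, forall (xs : 'rV[R]_p) (ys zs : 'M[R]_(n, p)),
     cluster ((x k w, y k w, z k w) @[k --> \oo]) (xs, ys, zs) ->
     [/\ forall i, xs = row i ys,
         stationary r f xs
       & convex_ext (objective r f) -> argmin (objective r f) xs]}.
Proof.
have [mL mG] : gamma < beta /\ (2 * L + 2 < beta \/ 2 * L ^+ 2 + L + 2 < beta).
  by case: hwalk => -[]; rewrite gt_max => /andP[-> h] _; split=> //; [left|right].
have [L' [L'0 lf L'b L'b']] := walkman_parameters hbeta hf mG.
have [upd updE W] : exists2 upd : update_rule,
    upd = prox_update f beta \/ upd = grad_update f beta &
    forall w, walkman r beta upd y0 z0 (i_ ^~ w) (x ^~ w) (xbar ^~ w) (y ^~ w) (z ^~ w).
  case: hwalk => -[_ W]; first by exists (prox_update f beta) => //; left.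
  by exists (grad_update f beta) => //; right.
pose E i (t : nat) k :=
  [set w | (t.+1%:R : R)^-1 <= enorm (x k.+1 w - row i (y k.+1 w))].
have prox_u v u u' : prox beta^-1 r v u -> prox beta^-1 r v u' -> u = u'.
  exact: (prox_unique hr hbeta mL hsc).
have upd_u i v yi zi u u' : upd i v yi zi u -> upd i v yi zi u' -> u = u'.
  case: updE => ->; last by move=> -> ->.
  apply: (prox_update_unique hbeta L'0 lf).
  have : 0 <= L' ^+ 2 / beta by rewrite divr_ge0 ?sqr_ge0 ?ltW.
  by lra.
have dE i t k : determined i_ k (E i t k).
  move=> w w' ww'; rewrite /E /=.
  by have [-> ->] := walkman_unique prox_u upd_u (W w) (W w') ww'.
(* Infinitely many visits to [i]: the case of the event that always occurs. *)
have H1 i : {ae Pr, forall w, forall K, exists2 k, (K <= k)%N & i_ k w = i}.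
  have dT k : determined i_ k setT by [].
  have := infinitely_often_visit hP hi i hirr dT; apply: filterS => w h.
  have [|m hm] := h; first by move=> K; exists K.
  move=> K; have [k Kk [_ ik]] := hm K.
  by exists (k + m)%N => //; rewrite (leq_trans Kk)// leq_addr.
have H2 i : {ae Pr, forall w, forall t : nat, infinitely_often (E i t) w ->
    exists m, infinitely_often (fun k => E i t k `&` (i_ (k + m)%N @^-1` [set i])) w}.
  by apply: ae_foralln => t; apply: infinitely_often_visit hP hi _ _ hirr _.
have := filter_forall (F := almost_everywhere Pr) (ae_filter_ringOfSetsType Pr) H1.
have := filter_forall (F := almost_everywhere Pr) (ae_filter_ringOfSetsType Pr) H2.
(* The exceptional null set is fixed before the limit point, so it serves all limit points at
   once. *)
apply: filterS2 => w h2 h1 xs ys zs cl.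
have [hys sub] := walkman_cluster hr hsc hlsc lf hbounded L'0 hbeta mL L'b L'b'
  updE (W w) h1 (fun i t => h2 i t) cl.
split=> //; first exact: semi_subgradient_stationary sub.
exact: (semi_subgradient_argmin lf sub).
Qed.
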